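(* Let $n\geq 1$ be an integer and let $X$ be a locally compact separable metric space. The following conditions are equivalent: (i) $X\in\mathrm{AE}_p(n)$; (ii) the one-point compactification $\omega X=X\cup\{\omega\}$ is an $\mathrm{AE}(n)$-space and $\{\omega\}$ is a $Z_n$-set in $\omega X$; (iii) there exists a metrizable compactification $\widetilde X$ of $X$ such that both $\widetilde X$ and the remainder $\widetilde X\setminus X$ are $\mathrm{AE}(n)$-spaces, and $\widetilde X\setminus X$ is a $Z_n$-set in $\widetilde X$.
   Context: All spaces are Hausdorff, all maps are continuous, and $\dim$ is covering dimension. A map $f:X\to Y$ is proper if $f^{-1}(K)$ is compact for every compact $K\subset Y$. A locally compact space $X$ is a proper absolute extensor for the class of at most $n$-dimensional spaces, written $X\in\mathrm{AE}_p(n)$, if for every locally compact Lindelöf space $Y$ with $\dim Y\le n$ and every closed $A\subset Y$, every proper map $f:A\to X$ extends to a proper map $Y\to X$. A locally compact metrizable space $X$ is an $\mathrm{AE}(n)$-space if for every locally compact Lindelöf metric space $Y$ with $\dim Y\le n$ and every closed $A\subset Y$, every map $f:A\to X$ extends to a map $Y\to X$. (The empty set $A$ is allowed in both definitions.) $\mathbb B^n$ is the closed $n$-dimensional ball (cube), and $C(Z,X)$ is the set of continuous maps $Z\to X$ with the compact-open topology. A closed subset $A\subset X$ is a $Z_n$-set in $X$ if $C(\mathbb B^n,X\setminus A)$ is dense in $C(\mathbb B^n,X)$. $\omega X$ denotes the one-point compactification of $X$, with added point $\omega$. *)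

(* Defs.v *)
From HB Require Import structures.
From mathcomp Require Import all_boot all_order all_algebra.
From mathcomp Require Import all_classical all_reals all_analysis.

Set Implicit Arguments.
Unset Strict Implicit.
Unset Printing Implicit Defensive.

Import Order.TTheory GRing.Theory Num.Theory.
Import numFieldNormedType.Exports.

Local Open Scope classical_set_scope.
Local Open Scope ring_scope.

Definition separable (T : topologicalType) : Prop :=
  exists2 D : set T, countable D & dense D.

Definition lindelof (T : topologicalType) : Prop :=
  forall U : set (set T), U `<=` open -> \bigcup_(O in U) O = [set: T] ->
    exists V : set (set T),
      [/\ V `<=` U, countable V & \bigcup_(O in V) O = [set: T]].

Definition metrizable (R : realType) (T : topologicalType) : Prop :=
  exists d : T -> T -> R,
    [/\ forall x y, 0 <= d x y,
        forall x y, d x y = 0 <-> x = y,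
        forall x y, d x y = d y x,
        forall x y z, d x z <= d x y + d y z
      & forall x, nbhs x =
          filter_from [set e : R | 0 < e] (fun e => [set y | d x y < e])].

Definition finite_open_cover (T : topologicalType) (k : nat)
    (U : 'I_k -> set T) : Prop :=
  (forall i, open (U i)) /\ \bigcup_i U i = [set: T].

(* dim T <= n, in the form appropriate for normal spaces: every finite open
   cover has a finite open refinement no point of which lies in more than
   n + 1 members.  Locally compact Lindelof Hausdorff spaces are normal. *)
Definition covering_dim_le (T : topologicalType) (n : nat) : Prop :=
  forall (k : nat) (U : 'I_k -> set T), finite_open_cover U ->
    exists (l : nat) (V : 'I_l -> set T),
      [/\ finite_open_cover V,
          forall j, exists i, V j `<=` U i
        & forall x : T, (#|[set j : 'I_l | `[< V j x >]]%SET| <= n.+1)%N].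

Definition proper_map (X Y : topologicalType) (f : X -> Y) : Prop :=
  continuous f /\ forall K : set Y, compact K -> compact (f @^-1` K).

(* In the two definitions below a closed subset A of Y carries the topology of
   the subtype set_type A.  A partial map given by a total function on Y would
   not do: if X is empty there is none, even when A is empty. *)
Definition AEp (n : nat) (X : topologicalType) : Prop :=
  [/\ hausdorff_space X,
      locally_compact [set: X]
    & forall Y : topologicalType,
        hausdorff_space Y -> locally_compact [set: Y] -> lindelof Y ->
        covering_dim_le Y n ->
        forall (A : set Y) (f : set_type A -> X),
          closed A -> proper_map f ->
          exists2 g : Y -> X, proper_map g & forall a, g (set_val a) = f a].

Definition AE (R : realType) (n : nat) (X : topologicalType) : Prop :=
  [/\ locally_compact [set: X],
      metrizable R X
    & forall Y : metricType R,
        locally_compact [set: Y] -> lindelof Y -> covering_dim_le Y n ->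
        forall (A : set Y) (f : set_type A -> X),
          closed A -> continuous f ->
          exists2 g : Y -> X, continuous g & forall a, g (set_val a) = f a].

(* [-1, 1]^n, the closed unit ball of R^n for the sup norm. *)
Definition cube (R : realType) (n : nat) : topologicalType :=
  set_type [set x : 'rV[R]_n | forall i, `|x ord0 i| <= 1].

Section Zset.
(* gives continuousType the compact-open topology *)
Import ArrowAsCompactOpen.

Definition Zset (R : realType) (n : nat) (X : topologicalType) (A : set X) :
    Prop :=
  closed A /\
  dense [set g : continuousType (cube R n) X | range g `<=` ~` A].

End Zset.

(* The second clause says that i is a topological embedding. *)
Definition compactification (X K : topologicalType) (i : X -> K) : Prop :=
  [/\ compact [set: K] /\ hausdorff_space K,
      injective i /\ @open X = [set i @^-1` V | V in @open K]
    & dense (range i)].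

(* Main.v *)
Require Import Defs.
From HB Require Import structures.
From mathcomp Require Import all_boot all_order all_algebra finmap.
From mathcomp Require Import all_classical all_reals all_analysis.
From mathcomp Require Import zify ring lra.

Set Implicit Arguments.
Unset Strict Implicit.
Unset Printing Implicit Defensive.

Import Order.TTheory GRing.Theory Num.Theory.
Import numFieldNormedType.Exports.

Local Open Scope classical_set_scope.

Local Open Scope ring_scope.

(** A compact metrizable space [W] is embedded, by a countable family of
    functions, in the space of real sequences with the distance [seqdist]. Maps
    to [W] extend to maps of sequences by Tietze's theorem; the whole proof
    rests on a way to push such maps back to [W], or into a subset [X] of [W].

    The subset enters through two properties of maps of the cube [[-1, 1]^n]
    alone: partial maps into [X], defined on closed subsets, extend to maps into
    [X] ([relAE]), and near each point of [W] they extend without getting large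
    ([relLC]). By [controlled_extension] these imply that a map [F] of sequences
    on a locally compact space of dimension at most [n] can be moved into [X]
    over the set where a function [s] is positive, the displacement being small
    where both [s] and the distance from [F] to [W] are, and left as it is on
    [s = 0]. The proof is the classical one: a fine cover of order at most
    [n + 1], the nerve of which is mapped to [X] over its skeleta ([nerve_map]), each
    simplex being parametrised by part of the cube so that the two properties
    apply to it.

    The properties themselves come from the hypotheses. An absolute extensor
    extends maps of the cube, whose dimension is at most [n] ([cube_dim], with
    Kolmogorov's boxes). It is then locally connected at its own points, since
    an extension of maps placed on a sequence of cubes shrinking to a point is
    continuous at that point ([relLC_at]). For an extensor for proper maps, the
    disjoint union of a sequence of cubes gives the same at the added point of
    the one-point compactification ([relLC_infinity]). The complement of a Z-set
    inherits both properties ([relAE_setC], [relLC_setC]), since maps of the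
    cube can be pushed off the set away from the place where they are
    prescribed.

    From the first condition to the second, [X] has both properties in its
    one-point compactification, and [controlled_extension] extends arbitrary
    maps and pushes maps of the cube off the added point. The one-point
    compactification is an instance of the third condition. From the third
    condition to the first, a proper map on a closed subset of [Y] tends to the
    remainder at infinity. It is extended by following, near infinity, a map of
    [Y] to the remainder which it approaches, and by pushing the result into [X]
    with a displacement that tends to [0] at infinity, so that the extension
    still tends to the remainder, which means that it is proper
    ([compactification_AEp]). *)


(** * Points of the product of countably many lines *)

Section SequenceDistance.
Context {R : realType}.
Implicit Types (a b c : nat -> R) (r : R).

(** Truncating the [i]-th coordinate at [1 / (i + 1)] makes the supremum finite
    for all sequences and makes it a metric for the product topology: a bound
    [r > 0] constrains only the finitely many [i] with [r < 1 / (i + 1)]. *)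
Definition seqdist a b : R :=
  sup (range (fun i => Num.min `|a i - b i| i.+1%:R^-1)).

Lemma seqdist_le a b r :
  seqdist a b <= r <-> forall i, Num.min `|a i - b i| i.+1%:R^-1 <= r.
Proof.
have ub : has_sup (range (fun i => Num.min `|a i - b i| (i.+1%:R^-1 : R))).
  split; first by exists (Num.min `|a 0 - b 0| 1%:R^-1); exists 0.
  exists 1 => _ [i _ <-]; rewrite ge_min invf_le1 ?ltr0n// ler1n orbT.
  by [].
split=> [abr i|abr]; first by apply: le_trans abr; apply: (ub_le_sup (proj2 ub)); exists i.
by apply: ge_sup; [case: ub|move=> _ [i _ <-]].
Qed.

Lemma seqdist_coord a b i : Num.min `|a i - b i| i.+1%:R^-1 <= seqdist a b.
Proof. by move: i; apply/seqdist_le. Qed.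

Lemma seqdist_ge0 a b : 0 <= seqdist a b.
Proof.
by apply: le_trans (seqdist_coord a b 0); rewrite le_min normr_ge0 invr_ge0 ler0n.
Qed.
Hint Resolve seqdist_ge0 : core.

Lemma seqdistxx a : seqdist a a = 0.
Proof.
apply/eqP; rewrite eq_le seqdist_ge0 andbT; apply/seqdist_le => i.
by rewrite subrr normr0 ge_min lexx.
Qed.

Lemma seqdistC a b : seqdist a b = seqdist b a.
Proof.
rewrite /seqdist.
suff -> : (fun i => Num.min `|a i - b i| (i.+1%:R^-1 : R)) =
  (fun i => Num.min `|b i - a i| i.+1%:R^-1) by [].
by apply/funext => i; rewrite distrC.
Qed.

Lemma min_triangle (x y z w p q : R) : z <= x + y -> 0 <= p -> 0 <= q ->
  Num.min x w <= p -> Num.min y w <= q -> Num.min z w <= p + q.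
Proof.
rewrite !ge_min => zxy p0 q0 /orP[xp|wp] /orP[yq|wq]; apply/orP.
- by left; lra.
- by right; lra.
- by right; lra.
- by right; lra.
Qed.

Lemma seqdist_triangle b a c : seqdist a c <= seqdist a b + seqdist b c.
Proof.
apply/seqdist_le => i; apply: (min_triangle _ _ _ (seqdist_coord a b i)
  (seqdist_coord b c i)) => //.
exact: ler_distD.
Qed.

Lemma seqdist_eq0 a b : seqdist a b <= 0 -> a = b.
Proof.
move=> ab0; apply/funext => i; have := le_trans (seqdist_coord a b i) ab0.
have : 0 < i.+1%:R^-1 :> R by rewrite invr_gt0 ltr0n.
rewrite ge_min => /[swap] /orP[|/le_lt_trans/[apply]]; last by rewrite ltxx.
by rewrite normr_le0 subr_eq0 => /eqP.
Qed.

Lemma seqdist_lip a b c : `|seqdist a c - seqdist b c| <= seqdist a b.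
Proof.
have := seqdist_triangle b a c; have := seqdist_triangle a b c.
by rewrite (seqdistC b a) ler_norml; lra.
Qed.

(** The truncation leaves only finitely many coordinates to control. *)
Lemma seqdist_cvg {T : Type} (F : set_system T) {FF : Filter F}
    (f : T -> nat -> R) (a : nat -> R) :
  (forall i, (fun t => f t i) @ F --> a i) ->
  forall r, 0 < r -> \forall t \near F, seqdist a (f t) <= r.
Proof.
move=> fa r r0; have [N Nr] : exists N : nat, N.+1%:R^-1 < r.
  near \oo => N; exists N; near: N; exact: near_infty_natSinv_lt (PosNum r0).
have : \forall t \near F, forall i, (i < N)%N -> `|a i - f t i| <= r.
  elim: N {Nr} => [|N IH]; first by apply: nearW => t i.
  have /cvgr_dist_le/(_ r r0) := fa N; apply: filterS2 IH => t IH aN i.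
  by rewrite ltnS leq_eqVlt => /orP[/eqP->//|/IH].
apply: filterS => t fr; apply/seqdist_le => i; rewrite ge_min.
have [/fr->//|Ni] := ltnP i N; apply/orP; right; apply: le_trans (ltW Nr).
by rewrite lef_pV2 ?posrE ?ltr0n// ler_nat ltnS.
Unshelve. all: by end_near. Qed.

Lemma seqdist_cvgP {T : Type} (F : set_system T) {FF : Filter F}
    (f : T -> nat -> R) (a : nat -> R) :
  (forall r, 0 < r -> \forall t \near F, seqdist a (f t) <= r) ->
  forall i, (fun t => f t i) @ F --> a i.
Proof.
move=> fa i; apply/cvgrPdist_le => /= r r0.
have i0 : 0 < i.+1%:R^-1 :> R by rewrite invr_gt0 ltr0n.
pose r' := Num.min r (i.+1%:R^-1 / 2).
have r'0 : 0 < r' by rewrite lt_min r0 divr_gt0.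
apply: filterS (fa _ r'0) => t; move/(le_trans (seqdist_coord a (f t) i)).
rewrite ge_min => /orP[|]; rewrite le_min => /andP[]//.
by move=> _; rewrite leNgt ltr_pdivrMr// ltr_pMr// ltr1n.
Qed.

Lemma continuous_seqdist {T : topologicalType} (f g : T -> nat -> R) :
  (forall i, continuous (f^~ i)) -> (forall i, continuous (g^~ i)) ->
  continuous (fun t => seqdist (f t) (g t)).
Proof.
move=> cf cg x; apply/cvgrPdist_le => /= r r0.
have r20 : 0 < r / 2 by rewrite divr_gt0.
apply: filterS2 (seqdist_cvg (fun i => cf i x) r20) (seqdist_cvg (fun i => cg i x) r20).
move=> t xf xg.
have := seqdist_lip (f x) (f t) (g x); have := seqdist_lip (g x) (g t) (f t).
have := ler_distD (seqdist (f t) (g x)) (seqdist (f x) (g x)) (seqdist (f t) (g t)).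
rewrite (seqdistC (g x) (f t)) (seqdistC (g t) (f t)) => h1 h2 h3.
by apply: le_trans h1 _; rewrite (splitr r) lerD// ?(le_trans h3)// (le_trans h2).
Qed.

Definition setdist (S : set (nat -> R)) a : R := inf (seqdist a @` S).

Lemma setdist_ge0 (S : set (nat -> R)) a : 0 <= setdist S a.
Proof.
have [[b Sb]|/nonemptyPn S0] := pselect (S !=set0).
  by apply: lb_le_inf; [exists (seqdist a b); exists b|move=> _ [c _ <-]].
by rewrite /setdist S0 image_set0 inf0.
Qed.

Lemma setdist_le (S : set (nat -> R)) a b : S b -> setdist S a <= seqdist a b.
Proof. by move=> Sb; apply: ge_inf; [exists 0 => _ [c _ <-]|exists b]. Qed.

Lemma setdist_lt (S : set (nat -> R)) a r :
  S !=set0 -> setdist S a < r -> exists2 b, S b & seqdist a b < r.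
Proof.
move=> [c Sc]; have S0 : (seqdist a @` S) !=set0 by exists (seqdist a c); exists c.
by move=> /(inf_lt S0)[_ [b Sb <-] ?]; exists b.
Qed.

Lemma setdist_lip (S : set (nat -> R)) a b :
  S !=set0 -> setdist S b <= setdist S a + seqdist a b.
Proof.
move=> S0; apply/ler_addgt0Pr => r r0.
have [c Sc ac] : exists2 c, S c & seqdist a c < setdist S a + r.
  by apply: setdist_lt => //; rewrite ltrDl.
have := setdist_le b Sc; have := seqdist_triangle a b c.
by rewrite (seqdistC b a); lra.
Qed.

Lemma setdist0 (S : set (nat -> R)) a : S a -> setdist S a = 0.
Proof.
move=> Sa; apply/eqP; rewrite eq_le setdist_ge0 andbT.
by rewrite -(seqdistxx a) setdist_le.
Qed.

Lemma continuous_setdist {T : topologicalType} (S : set (nat -> R))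
    (f : T -> nat -> R) : S !=set0 ->
  (forall i, continuous (f^~ i)) -> continuous (fun t => setdist S (f t)).
Proof.
move=> S0 cf x; apply/cvgrPdist_le => /= r r0.
apply: filterS (seqdist_cvg (fun i => cf i x) r0) => t xt.
have := setdist_lip (f x) (f t) S0; have := setdist_lip (f t) (f x) S0.
rewrite (seqdistC (f t)) => h1 h2.
by rewrite ler_norml; apply/andP; split; lra.
Qed.

(** The distance of the sequence [h^~ t] to [0] serves as a convergent sum of
    the functions [h m], without any bound on them. *)
Lemma cozero_bigcup {T : topologicalType} (h : nat -> T -> R) :
  (forall m, continuous (h m)) -> (forall m t, 0 <= h m t) ->
  exists H : T -> R, [/\ continuous H, forall t, 0 <= H t
    & forall t, 0 < H t <-> exists m, 0 < h m t].
Proof.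
move=> ch h0; exists (fun t => seqdist (h^~ t) (fun=> 0)); split=> //.
  by apply: continuous_seqdist => // i t; exact: cvg_cst.
move=> t; split=> [|[m hm]].
  apply: contraPP => /forallNP hm; apply/negP; rewrite -leNgt; apply/seqdist_le => i.
  by have /negP := hm i; rewrite -leNgt subr0 (ger0_norm (h0 _ _)) ge_min => ->.
apply: lt_le_trans (seqdist_coord _ _ m).
by rewrite subr0 lt_min normr_gt0 gt_eqF//= invr_gt0 ltr0n.
Qed.

End SequenceDistance.
#[local] Hint Resolve seqdist_ge0 setdist_ge0 : core.

(** * Compactness and separation *)

Section CompactnessTools.
Context {R : realType}.

Lemma compact_finite_cover (T : topologicalType) (K : set T) (P : T -> set T) :
  compact K -> (forall x, K x -> nbhs x (P x)) ->
  exists2 s : seq T, (forall x, x \in s -> K x)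
    & forall y, K y -> exists2 x, x \in s & P x y.
Proof.
move=> /compact_near_coveringP cK KP.
(* Finite lists of points of [K], directed by inclusion, are the filter along
   which being covered is eventually true near each point. *)
pose F : set_system (seq T) := filter_from [set s : seq T | forall x, x \in s -> K x]
  (fun s => [set t : seq T | {subset s <= t} /\ forall x, x \in t -> K x]).
have FF : ProperFilter F.
  apply: filter_from_proper => [|s Ks]; last by exists s; split.
  apply: filter_from_filter; first by exists [::].
  move=> s t Ks Kt; exists (s ++ t).
    by move=> x; rewrite mem_cat => /orP[xs|xt]; [exact: Ks|exact: Kt].
  move=> u [stu Ku].
  have su : {subset s <= u} by move=> x xs; apply: stu; rewrite mem_cat xs.
  by have tu : {subset t <= u} by move=> x xt; apply: stu; rewrite mem_cat xt orbT.
have [|s [Ks sP]] := @filter_ex _ _ FF [set s : seq T | (forall x, x \in s -> K x) /\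
    K `<=` [set y | exists2 x, x \in s & P x y]].
  apply: filterI; first by exists [::] => // t [].
  apply: (cK (seq T) F (fun s y => exists2 x, x \in s & P x y) _ _) => x Kx.
  exists (P x, [set t : seq T | x \in t]) => /=; last by move=> [y t] /= [Pxy xt]; exists x.
  split; first exact: KP.
  exists [:: x] => [y|t [xt _]]; first by rewrite inE => /eqP->.
  by apply: xt; rewrite inE.
by exists s => // y Ky; exact: sP.
Qed.

Lemma seq_positive_min (T : eqType) (s : seq T) (f : T -> R) :
  (forall x, x \in s -> 0 < f x) -> exists2 r, 0 < r & forall x, x \in s -> r <= f x.
Proof.
elim: s => [|a s IH] sf; first by exists 1.
have [|r r0 rs] := IH; first by move=> x xs; apply: sf; rewrite inE xs orbT.
exists (Num.min r (f a)); first by rewrite lt_min r0 sf ?mem_head.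
by move=> x; rewrite inE ge_min => /orP[/eqP->|/rs->//]; rewrite lexx orbT.
Qed.

Lemma compact_positive_min (T : topologicalType) (K : set T) (f : T -> R) :
  compact K -> continuous f -> (forall x, K x -> 0 < f x) ->
  exists2 r, 0 < r & forall x, K x -> r <= f x.
Proof.
move=> cK cf f0.
have [x Kx|s sK scov] := compact_finite_cover (P := fun x => [set y | f x / 2 < f y]) cK.
  by apply: (cvgr_gt _ (cf x)); rewrite ltr_pdivrMr// ltr_pMr ?ltr1n// f0.
have [|r r0 rs] := @seq_positive_min T s (fun x => f x / 2).
  by move=> x /sK Kx; rewrite divr_gt0// f0.
by exists r => // x /scov[y /rs ry yx]; rewrite (le_trans ry)// ltW.
Qed.

Lemma locally_compact_bump (T : topologicalType) (x : T) (O : set T) :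
  locally_compact [set: T] -> hausdorff_space T -> open O -> O x ->
  exists h : T -> R, [/\ continuous h, forall t, 0 <= h t <= 1, h x = 1
    & forall t, 0 < h t -> O t].
Proof.
move=> lT hT oO Ox.
have := @locally_compact_completely_regular T R lT hT x (~` O) (open_closedC oO).
move=> /(_ (fun h => h Ox))/(@uniform_separatorP T R) [f [cf f01 fx fO]].
exists (fun t => 1 - f t); split.
- by move=> t; apply: cvgB; [exact: cvg_cst|exact: cf].
- move=> t; have : range f (f t) by exists t.
  by move/f01; rewrite /= in_itv/= => /andP[? ?]; apply/andP; split; lra.
- by rewrite (fx (f x)) ?subr0//; exists x.
- move=> t; apply: contraPP => nOt; rewrite (fO (f t)) ?subrr ?ltxx//.
Qed.

Lemma normal_separation (T : topologicalType) (A B : set T) :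
  normal_space T -> closed A -> closed B -> A `&` B = set0 ->
  exists h : T -> R, [/\ continuous h, forall t, 0 <= h t <= 1,
    forall t, A t -> h t = 0 & forall t, B t -> h t = 1].
Proof.
move=> nT cA cB AB0; have /normal_separatorP := nT.
move=> /(_ R) /(_ _ _ cA cB AB0)/(@uniform_separatorP T R) [f [cf f01 fA fB]].
exists f; split=> //.
- by move=> t; have : range f (f t) by []; move/f01; rewrite /= in_itv.
- by move=> t At; apply: fA; exists t.
- by move=> t Bt; apply: fB; exists t.
Qed.

End CompactnessTools.

(** * Locally compact Lindelof spaces *)

Section LocallyCompactLindelof.
Context {R : realType} (Y : topologicalType).
Hypotheses (hY : hausdorff_space Y) (lY : locally_compact [set: Y]) .
Local Notation opc := (one_point_compactification Y).

Lemma one_point_compactification_normal : normal_space opc.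
Proof.
apply: compact_normal; first exact: one_point_compactification_hausdorff.
exact: one_point_compactification_compact.
Qed.

Lemma compact_superlevel (u : opc -> R) (r : R) :
  continuous u -> u None < r -> compact [set y | r <= u (Some y)].
Proof.
move=> cu ur; have [K [cK clK] Ku] : nbhs (None : opc) [set z | u z < r].
  by have /cvgr_lt := cu None; apply.
apply: subclosed_compact cK _.
  apply: (@closed_comp _ _ (u \o (Some : Y -> opc)) [set t | r <= t]); last exact: closed_ge.
  by move=> y _; apply: continuous_comp; [exact: one_point_compactification_some_continuous|exact: cu].
move=> y /= ry; apply: contrapT => nKy.
by have := Ku (Some y); rewrite /= ltNge ry => /(_ _)/[!falseE]; apply; left; exists y.
Qed.

Lemma compact_cover_sequence : lindelof Y ->
  exists K : nat -> set Y, (forall m, compact (K m)) /\ forall y, exists m, K m y.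
Proof.
move=> lind; pose U := [set O : set Y | open O /\ exists2 K, compact K & O `<=` K].
have [||V [VU cV Vcov]] := lind U; first by move=> O [].
  apply/seteqP; split=> // y _; have [K] := @lY y I; rewrite withinET => Ky [cK _].
  exists K°; last by [].
  by split; [exact: open_interior|exists K => //; exact: interior_subset].
have /countable_injP[f finj] := cV.
have /choice[K KP] : forall m, exists K, compact K /\
    forall O, V O -> f O = m -> O `<=` K.
  move=> m; have [ [Z VO fO]|nO] := pselect (exists2 O, V O & f O = m).
    have [_ [K cK OK]] := VU _ VO; exists K; split=> // O' VO' fO'.
    by rewrite (finj O' Z) ?inE// fO'.
  exists set0; split=> [|O VO fO]; first exact: compact0.
  by case: nO; exists O.
exists K; split=> [m|y]; first by case: (KP m).
have : [set: Y] y by []; rewrite -Vcov => -[Z VO Oy].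
by exists (f Z); case: (KP (f Z)) => _; apply; last exact: Oy.
Qed.

(** Functions equal to [1] on the members of a countable compact cover exist on
    the one-point compactification with value [0] at the added point, and
    [cozero_bigcup] combines them into one. *)
Lemma exhaustion_function : lindelof Y ->
  exists u : Y -> R, [/\ continuous u, forall y, 0 < u y
    & forall r, 0 < r -> compact [set y | r <= u y]].
Proof.
move=> /compact_cover_sequence[K [cK Kcov]].
have /choice[h hP] : forall m, exists h : opc -> R, [/\ continuous h,
    forall t, 0 <= h t <= 1, h None = 0 & forall y, K m y -> h (Some y) = 1].
  move=> m.
  have cKm : compact (Some @` K m : set opc).
    apply: continuous_compact (cK m); apply: continuous_subspaceT => y.
    exact: one_point_compactification_some_continuous.
  have ho := one_point_compactification_hausdorff lY hY.
  have [||h [ch h01 hN hK]] := @normal_separation R opc [set None] _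
      one_point_compactification_normal _ (compact_closed ho cKm).
  - by apply: compact_closed; [exact: ho|exact: compact_set1].
  - by rewrite -subset0 => _ [-> []].
  - by exists h; split=> // [|y Ky]; [exact: hN|apply: hK; exists y].
have [H [cH H0 HP]] := @cozero_bigcup R opc h (fun m => let: And4 c _ _ _ := hP m in c)
  (fun m t => let: And4 _ c _ _ := hP m in proj1 (andP (c t))).
have HN : H None = 0.
  apply/eqP; rewrite eq_le H0 andbT leNgt; apply/negP => /HP[m].
  by case: (hP m) => _ _ -> _; rewrite ltxx.
exists (H \o Some); split.
- move=> y; apply: continuous_comp; last exact: cH.
  exact: one_point_compactification_some_continuous.
- by move=> y; apply/HP; have [m Ky] := Kcov y; exists m; case: (hP m) => _ _ _ ->.
- by move=> r r0; apply: compact_superlevel => //; rewrite HN.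
Qed.

(** The part [m.+1%:R^-1 <= u] of a closed set [A] is compact, hence separated
    from a disjoint closed set [B] in the one-point compactification. Combining
    these functions gives one that is positive on [A] and zero on [B]; two of
    them are then compared. *)
Lemma lindelof_normal : lindelof Y -> normal_space Y.
Proof.
move=> lind; have [u [cu u0 uc]] := exhaustion_function lind.
have sep (A B : set Y) : closed A -> closed B -> A `&` B = set0 ->
    exists H : Y -> R, [/\ continuous H, forall y, A y -> 0 < H y
      & forall y, B y -> H y = 0].
  move=> cA cB AB0.
  have /choice[h hP] : forall m : nat, exists h : opc -> R, [/\ continuous h,
      forall t, 0 <= h t <= 1, forall y, B y -> h (Some y) = 0
      & forall y, A y -> m.+1%:R^-1 <= u y -> h (Some y) = 1].
    move=> m.
    have cK : compact (Some @` (A `&` [set y | m.+1%:R^-1 <= u y]) : set opc).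
      apply: continuous_compact; last first.
        by rewrite setIC; apply: compact_closedI => //; apply: uc; rewrite invr_gt0.
      apply: continuous_subspaceT => y.
      exact: one_point_compactification_some_continuous.
    have ho := one_point_compactification_hausdorff lY hY.
    have cB' : closed (Some @` B `|` [set None] : set opc).
      rewrite -openC (_ : ~` _ = Some @` (~` B)).
        by apply: one_point_compactification_open_some; exact: closed_openC.
      apply/seteqP; split=> [ [y|] /= nB|_ [y nB <-] [ [z Bz [zy]]|]//].
      + by exists y => // By; apply: nB; left; exists y.
      + by case: nB; right.
      + by apply: nB; rewrite -zy.
    have [|h [ch h01 hN hK]] := @normal_separation R _ _ _
        one_point_compactification_normal cB' (compact_closed ho cK).
    - rewrite -subset0 => _ [ [[z Bz <-]|->] [y [Ay _]]//] [yz].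
      have yAB : (A `&` B) y by split=> //; rewrite yz.
      by rewrite AB0 in yAB.
    - exists h; split=> // [y By|y Ay uy]; first by apply: hN; left; exists y.
      by apply: hK; exists y.
  have [H [cH H0 HP]] := @cozero_bigcup R opc h
    (fun m => let: And4 c _ _ _ := hP m in c)
    (fun m t => let: And4 _ c _ _ := hP m in proj1 (andP (c t))).
  exists (H \o Some); split.
  - move=> y; apply: continuous_comp; last exact: cH.
    exact: one_point_compactification_some_continuous.
  - move=> y Ay; apply/HP.
    have [m mu] : exists m, m.+1%:R^-1 < u y.
      near \oo => m; exists m; near: m; exact: near_infty_natSinv_lt (PosNum (u0 y)).
    by exists m; case: (hP m) => _ _ _ -> //; exact: ltW.
  - move=> y By; apply/eqP; rewrite eq_le H0 andbT leNgt; apply/negP => /HP[m].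
    by case: (hP m) => _ _ -> // _; rewrite ltxx.
apply/(@normal_openP R) => A B cA cB AB0.
have [H [cH HA HB]] := sep _ _ cA cB AB0.
have [G [cG GB GA]] := sep _ _ cB cA (etrans (setIC B A) AB0).
exists [set y | 0 < H y - G y], [set y | 0 < G y - H y]; split.
- by apply: (@open_comp _ _ (fun y => H y - G y) [set t | 0 < t]) => [y _|];
    [apply: cvgB; [exact: cH|exact: cG]|exact: open_gt].
- by apply: (@open_comp _ _ (fun y => G y - H y) [set t | 0 < t]) => [y _|];
    [apply: cvgB; [exact: cG|exact: cH]|exact: open_gt].
- by move=> y Ay /=; rewrite GA// subr0 HA.
- by move=> y By /=; rewrite HB// subr0 GB.
- by rewrite -subset0 => y /= []; lra.
Unshelve. all: by end_near. Qed.

End LocallyCompactLindelof.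

(** * Compact spaces embedded in a countable product of lines *)

Section SequenceEmbedding.
Context {R : realType} (W : topologicalType) (e : W -> nat -> R).

Definition seq_embedding : Prop :=
  [/\ compact [set: W], forall i, continuous (e^~ i),
      forall w i, `|e w i| <= 1 & injective e].

Hypothesis eW : seq_embedding.

Lemma seqdist_le1 (a b : nat -> R) : seqdist a b <= 1.
Proof. by apply/seqdist_le => i; rewrite ge_min invf_le1 ?ltr0n// ler1n orbT. Qed.

Lemma seqdist_gt0 w w' : w <> w' -> 0 < seqdist (e w) (e w').
Proof.
case: eW => _ _ _ ie ww'; rewrite ltNge; apply/negP => /seqdist_eq0/ie.
exact: ww'.
Qed.

Lemma seq_embedding_ball w r : 0 < r -> \forall w' \near w, seqdist (e w) (e w') < r.
Proof.
case: eW => _ ce _ _ r0.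
have /(_ w) cd : continuous (fun w' => seqdist (e w) (e w')).
  by apply: continuous_seqdist => // i w'; exact: cvg_cst.
by apply: (cvgr_lt _ cd); rewrite seqdistxx.
Qed.

(** The distance to [w] is bounded below on the compact complement of [V]. *)
Lemma seq_embedding_nbhs w (V : set W) : nbhs w V ->
  exists2 r, 0 < r & forall w', seqdist (e w) (e w') < r -> V w'.
Proof.
case: (eW) => cW ce _ _ wV.
have cK : compact (~` V°).
  by apply: subclosed_compact cW _ => //; apply: open_closedC; exact: open_interior.
have cd : continuous (fun w' => seqdist (e w) (e w')).
  by apply: continuous_seqdist => // i w'; exact: cvg_cst.
have [w' nVw'|r r0 rK] := compact_positive_min cK cd.
  by apply: seqdist_gt0 => ww'; apply: nVw'; rewrite -ww'.
exists r => // w' w'r; apply: contrapT => nVw'.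
by have := rK w' (fun h => nVw' (interior_subset h)); rewrite leNgt w'r.
Qed.

Lemma seq_embedding_cvg {T : Type} (F : set_system T) {FF : Filter F} (g : T -> W) w :
  (forall r, 0 < r -> \forall t \near F, seqdist (e w) (e (g t)) < r) -> g @ F --> w.
Proof.
move=> gw V /seq_embedding_nbhs[r r0 rV]; near_simpl.
by apply: filterS (gw _ r0) => t; exact: rV.
Qed.

Lemma seq_embedding_metrizable : metrizable R W.
Proof.
case: (eW) => _ _ _ ie.
exists (fun w w' => seqdist (e w) (e w')); split=> //.
- by move=> w w'; split=> [w0|->]; [apply/ie/seqdist_eq0; rewrite w0|exact: seqdistxx].
- by move=> *; exact: seqdistC.
- by move=> *; exact: seqdist_triangle.
- move=> w; apply/seteqP; split=> V.
    by move/seq_embedding_nbhs => [r r0 rV]; exists r.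
  by move=> [r /= r0 rV]; apply: filterS rV _; exact: seq_embedding_ball.
Qed.

Lemma setdist_embedding_eq0 (w0 : W) a : setdist (range e) a <= 0 -> exists w, e w = a.
Proof.
case: (eW) => cW ce _ _ da0; apply: contrapT => /forallNP ne.
have Se : range e !=set0 by exists (e w0); exists w0.
have cd : continuous (fun w => seqdist a (e w)).
  by apply: continuous_seqdist => // i w'; exact: cvg_cst.
have d0 w : 0 < seqdist a (e w).
  by rewrite ltNge; apply/negP => /seqdist_eq0 aw; exact: (ne w).
have [//|r r0 rd] := compact_positive_min cW cd.
have [_ [w _ <-] wr] := setdist_lt Se (le_lt_trans da0 r0).
by have := rd w I; rewrite leNgt wr.
Qed.

End SequenceEmbedding.

(** * Extension of maps defined on closed subsets of the cube *)

Section RelativeExtension.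
Context {R : realType} (n : nat).
Local Notation C := (cube R n).

(** [P] constrains the given partial map and [Q] its extension; both have values
    in [X], while continuity refers to the larger space [W]. *)
Definition extends_in (W : topologicalType) (X P Q : set W) : Prop :=
  forall (B : set C) (phi : C -> W), closed B -> {within B, continuous phi} ->
    (forall z, B z -> X (phi z) /\ P (phi z)) ->
    exists psi : C -> W, [/\ continuous psi, forall z, B z -> psi z = phi z
      & forall z, X (psi z) /\ Q (psi z)].

Definition relAE (W : topologicalType) (X : set W) : Prop := extends_in X setT setT.

(** Local connectedness in dimensions below [n], for maps that have to stay in
    [X]. Allowing any closed subset of the cube in place of the boundary spheres
    makes it usable for the faces of a simplex without triangulating anything. *)
Definition relLC (W : topologicalType) (X : set W) : Prop :=
  forall (w : W) V, nbhs w V -> exists2 V', nbhs w V' & extends_in X V' V.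

Lemma extends_inS (W : topologicalType) (X P P' Q Q' : set W) :
  P' `<=` P -> Q `<=` Q' -> extends_in X P Q -> extends_in X P' Q'.
Proof.
move=> PP QQ XPQ B phi cB cphi phiP.
have [|psi [cpsi psiB psiQ]] := XPQ B phi cB cphi; first by move=> z /phiP[? /PP].
by exists psi; split=> // z; have [? /QQ] := psiQ z.
Qed.

Definition modulus (eta : R -> R) : Prop :=
  [/\ forall a b, 0 < a -> a <= b -> eta a <= eta b, forall a, 0 < a -> 0 <= eta a
    & forall r, 0 < r -> exists2 d, 0 < d & forall a, 0 < a -> a < d -> eta a <= r].

Lemma modulus0 : modulus (fun=> 0).
Proof. by split=> // r r0; exists 1 => // *; exact: ltW. Qed.

Lemma modulusM (c : R) : 0 <= c -> modulus (fun a => c * a).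
Proof.
move=> c0; split=> [a b _|a a0|r r0]; first exact: ler_wpM2l.
  by rewrite mulr_ge0// ltW.
exists (r / (c + 1)); first by rewrite divr_gt0// ltr_wpDl.
move=> a a0; rewrite ltr_pdivlMr ?ltr_wpDl// => ar.
by apply: le_trans (ltW ar); rewrite mulrDr mulr1 mulrC lerDl ltW.
Qed.

Lemma modulusD (f g : R -> R) : modulus f -> modulus g -> modulus (fun a => f a + g a).
Proof.
move=> [f1 f2 f3] [g1 g2 g3]; split=> [a b a0 ab|a a0|r r0].
- by rewrite lerD ?f1 ?g1.
- by rewrite addr_ge0 ?f2 ?g2.
- have r20 : 0 < r / 2 by rewrite divr_gt0.
  have [d d0 fd] := f3 _ r20; have [d' d'0 gd] := g3 _ r20.
  exists (Num.min d d'); first by rewrite lt_min d0.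
  by move=> a a0; rewrite lt_min => /andP[ad ad']; rewrite (splitr r) lerD ?fd ?gd.
Qed.

Lemma modulus_comp (f g : R -> R) : modulus f -> modulus g ->
  (forall a, 0 < a -> 0 < g a) -> modulus (fun a => f (g a)).
Proof.
move=> [f1 f2 f3] [g1 g2 g3] g0; split=> [a b a0 ab|a a0|r r0].
- by rewrite f1 ?g1 ?g0.
- by rewrite f2 ?g0.
- have [d d0 fd] := f3 _ r0; have d20 : 0 < d / 2 by rewrite divr_gt0.
  have [d' d'0 gd] := g3 _ d20; exists d' => // a a0 ad'; apply: fd (g0 _ a0) _.
  by apply: le_lt_trans (gd _ a0 ad') _; rewrite ltr_pdivrMr// ltr_pMr ?ltr1n.
Qed.

(** By compactness, how far an extension has to move is controlled uniformly
    by the size of the map to be extended. *)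
Lemma relLC_modulus (W : topologicalType) (e : W -> nat -> R) (X : set W) :
  seq_embedding e -> relAE X -> relLC X ->
  exists2 zeta, modulus zeta & forall w a, 0 < a ->
    extends_in X [set w' | seqdist (e w) (e w') <= a]
      [set w' | seqdist (e w) (e w') <= zeta a].
Proof.
move=> eW aeX lcX; case: (eW) => cW _ _ _.
pose ball w a := [set w' | seqdist (e w) (e w') <= a].
have unif r : 0 < r -> exists2 d, 0 < d & forall w, extends_in X (ball w d) (ball w r).
  move=> r0; have r20 : 0 < r / 2 by rewrite divr_gt0.
  have /choice[d dP] : forall w, exists d, 0 < d /\
      extends_in X [set w' | seqdist (e w) (e w') < d] [set w' | seqdist (e w) (e w') < r / 2].
    move=> w; have [V' /(seq_embedding_nbhs eW)[d d0 dV'] XV] := lcX w _ (seq_embedding_ball eW w r20).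
    by exists d; split=> //; exact: extends_inS XV.
  have [w _|s _ scov] := @compact_finite_cover _ _
      (fun w => [set w' | seqdist (e w) (e w') < Num.min (r / 2) (d w / 2)]) cW.
    by apply: seq_embedding_ball; rewrite // lt_min r20 divr_gt0//; case: (dP w).
  have [|m m0 ms] := @seq_positive_min R W s (fun w => d w / 2).
    by move=> w _; rewrite divr_gt0//; case: (dP w).
  exists m => // w; have [//|a /[dup] /ms ma _] := scov w.
  rewrite /= lt_min => /andP[war wad].
  apply: extends_inS (proj2 (dP a)) => w'; rewrite /ball/= => ww'.
    by have := seqdist_triangle (e w) (e a) (e w'); lra.
  have := seqdist_triangle (e a) (e w) (e w'); rewrite (seqdistC (e w) (e a)).
  lra.
pose E a := [set r | 0 < r /\ forall w, extends_in X (ball w a) (ball w r)].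
have E0 a : E a !=set0.
  exists 1; split=> // w B phi cB cphi phiX.
  have [|psi [cpsi psiB psiX]] := aeX B phi cB cphi; first by move=> z /phiX[].
  exists psi; split=> // z; have [? _] := psiX z; split=> //.
  by rewrite /ball/=; exact: seqdist_le1.
have lE a : has_lbound (E a) by exists 0 => r [/ltW].
(* The infimum need not be attained; both terms keep the bound above it. *)
exists (fun a => 2 * inf (E a) + a).
  apply: modulusD; last first.
    split=> // [a /ltW//|r r0]; by exists r => // a _ /ltW.
  have inf0 a : 0 <= inf (E a) by apply: lb_le_inf => // r [/ltW].
  split=> [a b a0 ab|a a0|r r0].
  - rewrite ler_pM2l//; apply: lb_le_inf => // r [r0 rb]; apply: ge_inf => //.
    by split=> // w; apply: extends_inS (rb w) => // w' /= /le_trans; apply.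
  - by rewrite mulr_ge0.
  - have r20 : 0 < r / 2 by rewrite divr_gt0.
    have [d d0 dr] := unif _ r20; exists d => // a a0 ad.
    rewrite -ler_pdivlMl// mulrC; apply: ge_inf => //; split=> // w.
    by apply: extends_inS (dr w) => // w' /= /le_trans; apply; exact: ltW.
move=> w a a0; have inf0 : 0 <= inf (E a) by apply: lb_le_inf => // r [/ltW].
have [|r [r0 rE] ra] := @inf_lt _ (E a) (2 * inf (E a) + a) (E0 a); first by lra.
by apply: extends_inS (rE w) => // w' /= /le_trans; apply; exact: ltW.
Qed.

End RelativeExtension.

Arguments extends_in R n {W} X P Q.
Arguments relAE R n {W} X.
Arguments relLC R n {W} X.

(** * The cube *)

Section Cube.
Context {R : realType} {n : nat}.
Local Notation C := (cube R n).

Definition coord (z : C) (j : 'I_n) : R := set_val z ord0 j.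

Lemma coord_le1 z j : `|coord z j| <= 1.
Proof. by rewrite /coord; have := set_valP z; apply. Qed.

Lemma coord_inj z z' : (forall j, coord z j = coord z' j) -> z = z'.
Proof.
move=> zz'; apply/val_inj/rowP => j; have := zz' j.
by rewrite /coord set_valE.
Qed.

Lemma cube_cvg {T : Type} (F : set_system T) {FF : Filter F} (g : T -> C) (z : C) :
  (forall j, (fun t => coord (g t) j) @ F --> coord z j) -> g @ F --> z.
Proof.
move=> gz; apply/(@cvg_ballP R C) => r r0.
have : \forall t \near F, forall j, ball (coord z j) r (coord (g t) j).
  by apply: filter_forall => j; apply: (cvg_ball (gz j)).
apply: filterS => t gt; rewrite -initial_ballE; split=> // i j.
by rewrite (ord1 i); exact: gt.
Qed.

Lemma cube_coord_continuous (j : 'I_n) : continuous (coord^~ j).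
Proof.
move=> z; apply: (@continuous_comp _ _ _ (set_val : C -> 'rV[R]_n) (fun v => v ord0 j)).
  exact: initial_continuous.
exact: coord_continuous.
Qed.

(** Clipping makes [to_cube] total, so that points of the cube can be given by
    coordinates whose bounds are only checked where they are used. *)
Definition clip (x : R) : R := Num.max (-1) (Num.min 1 x).

Lemma clip_itv x : `|clip x| <= 1.
Proof.
rewrite /clip ler_norml le_max lexx ge_max/= ge_min lexx andbT.
by rewrite (le_trans (lerN10 _))//.
Qed.

Lemma clip_id x : -1 <= x <= 1 -> clip x = x.
Proof. by move=> /andP[x1 x2]; rewrite /clip (min_idPr x2) (max_idPr x1). Qed.

Lemma to_cube_subproof (v : 'I_n -> R) :
  [set x : 'rV[R]_n | forall i, `|x ord0 i| <= 1] (\row_j clip (v j)).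
Proof. by move=> j; rewrite mxE clip_itv. Qed.

Definition to_cube (v : 'I_n -> R) : C :=
  exist (fun x => x \in _) _ (mem_set (to_cube_subproof v)).

Lemma coord_to_cube v j : coord (to_cube v) j = clip (v j).
Proof. by rewrite /coord set_valE mxE. Qed.

Lemma to_cubeK z : to_cube (coord z) = z.
Proof.
by apply: coord_inj => j; rewrite coord_to_cube clip_id// -ler_norml coord_le1.
Qed.

Lemma to_cube_cvg {T : Type} (F : set_system T) {FF : Filter F}
    (v : T -> 'I_n -> R) (a : 'I_n -> R) :
  (forall j, (fun t => v t j) @ F --> a j) -> (fun t => to_cube (v t)) @ F --> to_cube a.
Proof.
move=> va; apply: cube_cvg => j.
under eq_fun do rewrite coord_to_cube; rewrite coord_to_cube.
have cc : continuous clip.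
  move=> x; apply: (@continuous_max R R (cst (-1)) (cst 1 \min id)).
    exact: cvg_cst.
  by apply: continuous_min; [exact: cvg_cst|exact: cvg_id].
exact: (continuous_cvg _ (cc (a j)) (va j)).
Qed.

Lemma cube_compact : compact [set: C].
Proof.
pose A := [set x : 'rV[R]_n | forall i, x ord0 i \in `[(-1 : R), 1]].
have cA : compact A.
  apply: (@rV_compact _ _ (fun=> `[(-1 : R), 1]%classic)) => _.
  exact: segment_compact.
have -> : [set: C] = (fun x : 'rV[R]_n => to_cube (x ord0)) @` A.
  apply/seteqP; split=> // z _; exists (set_val z); last exact: to_cubeK.
  by move=> i; rewrite in_itv/= -ler_norml; exact: coord_le1.
apply: continuous_compact cA; apply: continuous_subspaceT => x.
apply: (@to_cube_cvg _ (nbhs x) (nbhs_filter x) (fun y => y ord0) (x ord0)) => j.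
exact: coord_continuous.
Qed.

Lemma cube_hausdorff : hausdorff_space C.
Proof.
move=> z z' zz'; apply: coord_inj => j; apply: (@Rhausdorff R) => U V Uz Vz'.
have [w [/= Uw Vw]] := zz' _ _ (cube_coord_continuous Uz) (cube_coord_continuous Vz').
by exists (coord w j).
Qed.

End Cube.

Arguments cube_compact : clear implicits.
Arguments cube_hausdorff : clear implicits.

(** * Maps from a nerve, built over skeleta *)

Section Nerve.
Context {R : realType} {n : nat} (W : topologicalType) (I : choiceType).
Local Notation C := (cube R n).
Implicit Types (S T : {fset I}) (t : I -> R).

(** Weights are not normalised: the open simplex spanned by [S] is represented
    by the cone over it, and maps out of the nerve are homogeneous. *)
Definition cone S : set (I -> R) :=
  [set t | [/\ forall i, 0 <= t i, forall i, 0 < t i -> i \in S & exists i, 0 < t i]].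

Definition support t : {fset I} := fset_set [set i | 0 < t i].

Lemma in_support S t i : cone S t -> (i \in support t) = (0 < t i).
Proof.
move=> [_ tS _]; rewrite in_fset_set; first by apply/idP/idP; rewrite inE.
by apply: sub_finite_set (finite_fset S) => j /= /tS.
Qed.

Lemma support_sub S t : cone S t -> (support t `<=` S)%fset.
Proof. by move=> tS; apply/fsubsetP => i; rewrite (in_support _ tS); case: tS => _ + _; apply. Qed.

Lemma cone_support S t : cone S t -> cone (support t) t.
Proof.
move=> tS; have [t0 _ tp] := tS; split=> // i ti.
by rewrite (in_support _ tS).
Qed.

Lemma coneS S T t : (S `<=` T)%fset -> cone S t -> cone T t.
Proof. by move=> /fsubsetP ST [t0 tS tp]; split=> // i /tS/ST. Qed.

(** Continuity on the cone, tested through arbitrary parametrisations so that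
    no topology on [I -> R] is involved. *)
Definition cone_continuous (G : (I -> R) -> W) S : Prop :=
  forall (T : topologicalType) (D : set T) (p : T -> I -> R),
    (forall i, {within D, continuous (p^~ i)}) -> (forall x, D x -> cone S (p x)) ->
    {within D, continuous (fun x => G (p x))}.

(** Barycentric coordinates of the face [S], all but the one of the first
    vertex, as a point of the cube. *)
Definition bary S t : C :=
  to_cube (fun j : 'I_n => nth 0 [seq t i | i <- enum_fset S] j.+1 / \sum_(i <- S) t i).

Definition bary_coord S (z : C) (k : nat) : R :=
  if k is k'.+1 then (if insub k' is Some j then coord z j else 0)
  else 1 - \sum_(j < n | (j.+1 < #|` S|)%N) coord z j.

Definition unbary S (z : C) : I -> R :=
  fun i => if i \in S then bary_coord S z (index i (enum_fset S)) else 0.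

Lemma bary_sum_gt0 S t : cone S t -> 0 < \sum_(i <- S) t i.
Proof.
move=> [t0 tS [i ti]]; have iS := tS _ ti.
rewrite (big_rem i)//= ltr_wpDr//; apply: sumr_ge0 => j _; exact: t0.
Qed.

Lemma bary_scale S a t : 0 < a -> bary S (fun i => a * t i) = bary S t.
Proof.
move=> a0; congr to_cube; apply/funext => j.
rewrite -mulr_sumr invfM mulrA; congr (_ * _).
have [jS|jS] := ltnP j.+1 #|` S|; last by rewrite !nth_default ?size_map// mul0r.
have i0 : I by case: (enum_fset S) jS => [|i0 s].
by rewrite !(nth_map i0)// mulrAC divff ?mul1r// gt_eqF.
Qed.

Lemma sum_nth_ord (s : seq R) : (0 < size s <= n.+1)%N ->
  \sum_(x <- s) x = nth 0 s 0 + \sum_(j < n | (j.+1 < size s)%N) nth 0 s j.+1.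
Proof.
case: s => [//|x s] /= sn; rewrite big_cons (big_nth 0) big_mkord; congr (_ + _).
by rewrite (big_ord_widen n (fun j => nth 0 s j)).
Qed.

Lemma bary_coordE S t j : cone S t ->
  coord (bary S t) j = nth 0 [seq t i | i <- enum_fset S] j.+1 / \sum_(i <- S) t i.
Proof.
move=> tS; have s0 := bary_sum_gt0 tS; have [t0 _ _] := tS.
have nth0 k : 0 <= nth 0 [seq t i | i <- enum_fset S] k.
  have [kS|kS] := ltnP k (size [seq t i | i <- enum_fset S]); last by rewrite nth_default.
  by have /mapP[i _ ->] := mem_nth 0 kS.
rewrite coord_to_cube clip_id//; apply/andP; split.
  by rewrite (le_trans (lerN10 _))// divr_ge0// ltW.
rewrite ler_pdivrMr// mul1r.
have [jS|jS] := ltnP j.+1 (size [seq t i | i <- enum_fset S]); last first.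
  by rewrite nth_default// ltW.
have /mapP[i iS ->] := mem_nth 0 jS.
by rewrite (big_rem i)//= lerDl; apply: sumr_ge0 => k _; exact: t0.
Qed.

Lemma unbaryK S t i : (#|` S| <= n.+1)%N -> cone S t ->
  unbary S (bary S t) i = t i / \sum_(i <- S) t i.
Proof.
move=> Sn tS; have s0 := bary_sum_gt0 tS; have [t0 tpS [i1 /tpS i1S]] := tS.
rewrite /unbary; have [iS|niS] := boolP (i \in S); last first.
  have -> : t i = 0; last by rewrite mul0r.
  apply/eqP; rewrite eq_le t0 andbT leNgt; exact: (contra (tpS i) niS).
have kS : (index i (enum_fset S) < #|` S|)%N by rewrite index_mem.
have tn : nth 0 [seq t j | j <- enum_fset S] (index i (enum_fset S)) = t i.
  by rewrite (nth_map i)// nth_index.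
case: (index i (enum_fset S)) kS tn => [|k] kS tn /=.
  under eq_bigr do rewrite bary_coordE//.
  rewrite -mulr_suml -[X in X - _](@divff _ (\sum_(i <- S) t i)) ?gt_eqF// -mulrBl.
  have := @sum_nth_ord [seq t j | j <- enum_fset S].
  rewrite size_map big_map kS Sn tn => /(_ isT) {1}->.
  by rewrite addrK.
have kn : (k < n)%N by rewrite -ltnS (leq_trans kS).
by rewrite insubT/= bary_coordE//= tn.
Qed.

Lemma unbary_continuous S i : continuous (fun z => unbary S z i).
Proof.
rewrite /unbary; case: (i \in S) => /= z; have FF := @nbhs_filter C z; last exact: cvg_cst.
case: (index i (enum_fset S)) => [|k] /=.
  apply: cvgB; first exact: cvg_cst.
  apply: cvg_big => [|j _]; [exact: add_continuous|exact: cube_coord_continuous].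
by case: insub => [j|]; [exact: cube_coord_continuous|exact: cvg_cst].
Qed.

Definition face S i : set C :=
  [set z | (forall k, 0 <= unbary S z k) /\ unbary S z i = 0].

Lemma closed_face S i : closed (face S i).
Proof.
apply: closedI; last first.
  apply: (@closed_comp _ _ (fun z => unbary S z i) [set 0]); last exact: closed_eq.
  by move=> z _; exact: unbary_continuous.
have -> : (fun z => forall k, 0 <= unbary S z k) =
    \bigcap_(k in [set: I]) [set z | 0 <= unbary S z k].
  by apply/seteqP; split=> z zp => [k _|k]; exact: zp.
apply: closed_bigI => k _.
apply: (@closed_comp _ _ (fun z => unbary S z k) [set x | 0 <= x]); last exact: closed_ge.
by move=> z _; exact: unbary_continuous.
Qed.

Lemma cone_face S i z : (#|` S| <= n.+1)%N -> i \in S -> face S i z ->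
  cone (S `\ i)%fset (unbary S z).
Proof.
move=> Sn iS [z0 zi0]; split=> // [k zk|].
  rewrite !inE; apply/andP; split.
    by apply: contraTneq zk => ->; rewrite zi0 ltxx.
  by apply: contraLR zk => kS; rewrite /unbary (negbTE kS) ltxx.
apply: contrapT => /forallNP zN.
have zE k : unbary S z k = 0.
  by apply/eqP; rewrite eq_le z0 andbT leNgt; exact/negP.
have S0 : (0 < #|` S|)%N by case: (enum_fset S) (iS : i \in enum_fset S).
have hS : nth i (enum_fset S) 0 \in S by exact: mem_nth.
have := zE (nth i (enum_fset S) 0); rewrite /unbary hS index_uniq//= big1 ?subr0.
  by move/eqP; rewrite oner_eq0.
move=> j jS; have := zE (nth i (enum_fset S) j.+1).
rewrite /unbary ifT ?mem_nth// index_uniq//=.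
by case: insubP => [k _ kj|]; [rewrite (val_inj kj)|rewrite ltn_ord].
Qed.

End Nerve.

Section NerveMap.
Context {R : realType} {n : nat} (W : topologicalType) (I : choiceType).
Local Notation C := (cube R n).
Implicit Types (S T : {fset I}) (t : I -> R).

Lemma within_bigsetU (T : topologicalType) (J : eqType) (s : seq J) (A : J -> set T)
    (f : T -> W) : (forall j, closed (A j)) ->
  (forall j, j \in s -> {within A j, continuous f}) ->
  {within \big[setU/set0]_(j <- s) A j, continuous f}.
Proof.
move=> cA; elim: s => [|j s IH] fA; first by rewrite big_nil; exact: continuous_subspace0.
rewrite big_cons; apply: withinU_continuous => //.
- by apply: closed_bigsetU => k _; exact: cA.
- by apply: fA; rewrite mem_head.
- by apply: IH => k ks; apply: fA; rewrite inE ks orbT.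
Qed.

Lemma bary_within S (T : topologicalType) (D : set T) (p : T -> I -> R) :
  (forall i, {within D, continuous (p^~ i)}) -> (forall x, D x -> cone S (p x)) ->
  {within D, continuous (fun x => bary S (p x) : C)}.
Proof.
move=> cp pS; rewrite continuous_subspace_in => x /set_mem Dx.
have FF := @nbhs_filter (subspace D) x.
apply: to_cube_cvg => j; apply: cvgM.
  have [jS|jS] := ltnP j.+1 #|` S|; last first.
    under eq_cvg do rewrite nth_default ?size_map//.
    by rewrite nth_default ?size_map//; exact: cvg_cst.
  have i0 : I by case: (enum_fset S) jS => [|i0 s].
  under eq_cvg do rewrite (nth_map i0)//.
  by rewrite (nth_map i0)//; exact: cp.
apply: cvgV; first by rewrite gt_eqF// bary_sum_gt0//; exact: pS.
by apply: cvg_big => [|i _]; [exact: add_continuous|exact: cp].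
Qed.

Variables (e : W -> nat -> R) (X : set W) (zeta : R -> R).
Hypotheses (eW : seq_embedding e) (mzeta : modulus zeta).
Hypothesis zetaP : forall w (a : R), 0 < a ->
  extends_in R n X [set w' | seqdist (e w) (e w') <= a]
    [set w' | seqdist (e w) (e w') <= zeta a].

(** Displacement allowed on the faces with [m] vertices, in terms of the scale
    [r i] of a vertex. Scales at two vertices of a face differ at most by the
    factor [4]: passing from a vertex to the reference vertex of the face, and
    from there to a vertex of a smaller face, costs this factor twice. *)
Fixpoint skeleton_modulus (m : nat) : R -> R :=
  if m is m'.+1 then fun r =>
    r + zeta (4 * r + skeleton_modulus m' (4 * (4 * r))) + skeleton_modulus m' r
  else fun=> 0.

Lemma skeleton_modulusP m : modulus (skeleton_modulus m).
Proof.
elim: m => [|m IH]; first exact: modulus0.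
have m1 : modulus (id : R -> R).
  by split=> // [a /ltW//|r r0]; exists r => // a _ /ltW.
have m4 : modulus (fun a : R => 4 * a) by exact: modulusM.
have p4 (a : R) : 0 < a -> 0 < 4 * a by rewrite pmulr_rgt0.
have s4 : modulus (fun r => skeleton_modulus m (4 * (4 * r))).
  apply: (modulus_comp (g := fun r => 4 * (4 * r)) IH); last by move=> a a0; rewrite !p4.
  exact: (@modulus_comp _ (fun a => 4 * a) (fun a => 4 * a)).
apply: modulusD IH; apply: modulusD => //.
apply: (modulus_comp (g := fun r => 4 * r + skeleton_modulus m (4 * (4 * r))) mzeta).
  exact: modulusD.
by move=> a a0; case: s4 => _ s0 _; rewrite ltr_wpDr ?p4 ?s0.
Qed.

(** Induction on the number of vertices of a face. The map already defined on
    the boundary of a face is transported to a closed subset of the cube by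
    [unbary]; since its values are close to the label of a reference vertex,
    [zetaP] extends it over the cube without moving far from that label. *)
Lemma nerve_map (w0 : W) (N : {fset I} -> Prop) (w : I -> W) (r : I -> R) :
  (forall S T, (S `<=` T)%fset -> N T -> N S) ->
  (forall S, N S -> (#|` S| <= n.+1)%N) ->
  (forall S i j, N S -> i \in S -> j \in S ->
    [/\ 0 < r i, r j <= 4 * r i & seqdist (e (w i)) (e (w j)) <= r i]) ->
  exists G : (I -> R) -> W,
    (forall S, N S -> cone_continuous G S) /\
    (forall S t i, N S -> cone S t -> i \in S ->
      X (G t) /\ seqdist (e (w i)) (e (G t)) <= skeleton_modulus n.+1 (r i)).
Proof.
move=> Nsub Ncard Nr.
suff main m : (m <= n.+1)%N -> exists G : (I -> R) -> W, [/\
    forall S, N S -> (#|` S| <= m)%N -> cone_continuous G S,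
    forall S t i, N S -> (#|` S| <= m)%N -> cone S t -> i \in S ->
      X (G t) /\ seqdist (e (w i)) (e (G t)) <= skeleton_modulus m (r i)
    & forall a t, 0 < a -> G (fun i => a * t i) = G t].
  have [//|G [GC GX _]] := main n.+1.
  by exists G; split=> [S NS|S t i NS]; [apply: GC => //|apply: GX => //]; exact: Ncard.
elim: m => [|m IH] mn.
  have S0 S t : (#|` S| <= 0)%N -> cone S t -> False.
    by rewrite leqn0 => /eqP/cardfs0_eq-> [_ tS [i /tS]].
  exists (fun=> w0); split=> // [S _ _ T D p _ _|S t i _ /S0 + /[dup] tS].
    by apply: continuous_subspaceT => x; exact: cvg_cst.
  by move=> /(_ _ tS).
have [G [GC GX Gh]] := IH (ltnW mn).
have [sm sm0 _] := skeleton_modulusP m; have [zm zm0 _] := mzeta.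
pose bound i := r i + skeleton_modulus m (4 * r i).
have bound0 i S : N S -> i \in S -> 0 < bound i.
  move=> NS iS; have [ri _ _] := Nr _ _ _ NS iS iS.
  by rewrite /bound ltr_wpDr// sm0// mulr_gt0.
have /choice[H HP] : forall S, exists H : C -> W, N S -> (#|` S| = m.+1)%N ->
    [/\ continuous H, forall i z, i \in S -> face S i z -> H z = G (unbary S z)
      & forall i z, i \in S -> X (H z) /\
        seqdist (e (w i)) (e (H z)) <= skeleton_modulus m.+1 (r i)].
  move=> S; have [[NS Sm]|nS] := pselect (N S /\ #|` S| = m.+1); last first.
    by exists (fun=> w0) => NS Sm; case: nS.
  have Sn : (#|` S| <= n.+1)%N by rewrite Sm.
  have [i0 i0S] : exists i0, i0 \in S.
    by case iE : (enum_fset S) Sm => [//|i s] _; exists i;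
      rewrite -[i \in S]/(i \in enum_fset S) iE mem_head.
  have NSi i : N (S `\ i)%fset by apply: Nsub NS; exact: fsubD1set.
  have cardSi i : i \in S -> (#|` (S `\ i)%fset| <= m)%N.
    by move=> iS; have := cardfsD1 i S; rewrite iS Sm add1n => -[->].
  pose B : set C := \big[setU/set0]_(i <- enum_fset S) face S i.
  have BP z : B z -> exists2 i, i \in S & face S i z.
    by rewrite /B -bigcup_seq => -[i /= iS iz]; exists i.
  (* [i0] is the reference vertex. *)
  have [|||H [cH HB HX]] := @zetaP (w i0) _ (bound0 _ _ NS i0S) B (fun z => G (unbary S z)).
  - by apply: closed_bigsetU => i _; exact: closed_face.
  - apply: within_bigsetU => [i|i iS]; first exact: closed_face.
    apply: (GC _ (NSi i) (cardSi _ iS)) => [k|z iz]; last exact: cone_face.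
    by apply: continuous_subspaceT; exact: unbary_continuous.
  - move=> z /BP[i iS iz]; have zi := cone_face Sn iS iz.
    have [_ zS [j /zS jSi]] := zi.
    have jS : j \in S by move: jSi; rewrite !inE => /andP[].
    have [Xz zj] := GX _ _ _ (NSi i) (cardSi _ iS) zi jSi; split=> //=.
    have [ri rj wij] := Nr _ _ _ NS i0S jS; have [rj0 _ _] := Nr _ _ _ NS jS jS.
    apply: le_trans (seqdist_triangle (e (w j)) _ _) _; apply: lerD => //.
    by apply: le_trans zj _; exact: sm.
  - exists H => _ _; split=> // [i z iS iz|i z iS].
      by apply: HB; rewrite /B -bigcup_seq; exists i.
    have [Xz zi0] := HX z; split=> //.
    have [ri ri0 wi] := Nr _ _ _ NS iS i0S; have [ri00 _ _] := Nr _ _ _ NS i0S i0S.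
    apply: le_trans (seqdist_triangle (e (w i0)) _ _) _; rewrite /= -addrA.
    apply: lerD => //; rewrite -[leLHS]addr0; apply: lerD; last exact: sm0.
    apply: le_trans zi0 _; apply: zm; first exact: bound0 NS i0S.
    by apply: lerD => //; apply: sm; [rewrite mulr_gt0|rewrite ler_pM2l].
(* [support t] is the smallest face whose cone contains [t]. *)
pose G' t := if `[< N (support t) >] && (#|` support t| == m.+1) then
  H (support t) (bary (support t) t) else G t.
have G'small S t : cone S t -> (#|` S| <= m)%N -> G' t = G t.
  move=> tS Sm; rewrite /G'; case: ifP => // /andP[_ /eqP tm].
  by have := leq_trans (fsubset_leq_card (support_sub tS)) Sm; rewrite tm ltnn.
have G'big S t : N S -> #|` S| = m.+1 -> cone S t -> G' t = H S (bary S t).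
  move=> NS Sm tS; have Sn : (#|` S| <= n.+1)%N by rewrite Sm.
  have [tSE|tSN] := eqVneq (support t) S.
    by rewrite /G' tSE Sm eqxx andbT ifT//; exact/asboolP.
  have ltS : (support t `<` S)%fset by rewrite fproperEneq tSN support_sub.
  have tm : (#|` support t| <= m)%N by rewrite -ltnS -Sm fproper_ltn_card.
  rewrite (G'small _ _ (cone_support tS) tm).
  have /andP[_ /fsubsetPn[i iS nit]] := ltS.
  have [_ HG _] := HP S NS Sm; rewrite (HG i)//; last first.
    have [t0 _ _] := tS; have s0 := bary_sum_gt0 tS.
    split=> [k|]; rewrite unbaryK ?divr_ge0 ?(ltW s0)//.
    have -> : t i = 0; last by rewrite mul0r.
    by apply/eqP; rewrite eq_le t0 andbT leNgt -(in_support _ tS).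
  rewrite -(Gh (\sum_(i <- S) t i)^-1) ?invr_gt0 ?bary_sum_gt0//.
  by congr G; apply/funext => k; rewrite unbaryK// mulrC.
exists G'; split.
- move=> S NS; rewrite leq_eqVlt => /orP[/eqP Sm|Sm] T D p cp pS.
    have [cH _ _] := HP S NS Sm.
    apply: (@subspace_eq_continuous _ _ _ (fun x => H S (bary S (p x)))).
      by move=> x /set_mem Dx; rewrite /from_subspace (G'big S)//; exact: pS.
    by move=> x; apply: continuous_comp (cH _); exact: bary_within.
  apply: (@subspace_eq_continuous _ _ _ (fun x => G (p x))).
    by move=> x /set_mem Dx; rewrite /from_subspace (G'small S)//; exact: pS.
  exact: (GC S NS Sm T D p cp pS).
- move=> S t i NS; rewrite leq_eqVlt => /orP[/eqP Sm|Sm] tS iS.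
    by rewrite (G'big S)//; have [_ _] := HP S NS Sm; exact.
  rewrite (G'small S)//; have [Xt ti] := GX _ _ _ NS Sm tS iS; split=> //.
  have [ri _ _] := Nr _ _ _ NS iS iS.
  apply: le_trans ti _ => /=; rewrite lerDr addr_ge0 ?(ltW ri)//.
  by apply: zm0; rewrite ltr_wpDr ?mulr_gt0// sm0// !mulr_gt0.
- move=> a t a0; have sE : support (fun i => a * t i) = support t.
    by congr fset_set; apply/seteqP; split=> i /=; rewrite pmulr_rgt0.
  by rewrite /G' sE Gh// bary_scale.
Qed.

End NerveMap.

(** * Open covers of bounded order *)

Section Covers.
Context {R : realType} (Y : topologicalType) (n : nat).
Hypothesis dimY : covering_dim_le Y n.

Definition order_le (I : eqType) (V : I -> set Y) (y : Y) : Prop :=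
  forall t : seq I, uniq t -> (forall i, i \in t -> V i y) -> (size t <= n.+1)%N.

(** Merging the members of a refinement that lie in a given member of the
    cover turns a refinement into a shrinking. *)
Lemma finite_shrinking (I : eqType) (sq : seq I) (U : I -> set Y) (Z : set Y) :
  (forall i, open (U i)) -> open Z ->
  (forall y, Z y \/ exists2 i, i \in sq & U i y) ->
  exists V : I -> set Y, [/\ forall i, open (V i), forall i, V i `<=` U i,
    forall y, ~ Z y -> exists2 i, i \in sq & V i y & forall y, order_le V y].
Proof.
move=> oU oZ UZ; pose lbl (j : 'I_(size sq).+1) := nth None (None :: map some sq) j.
pose U' (o : option I) := if o is Some i then U i else Z.
have [] := dimY (k := (size sq).+1) (U := U' \o lbl).
  split=> [j|]; first by rewrite /=; case: (lbl j).
  apply/seteqP; split=> // y _; have [Zy|[i isq Uy]] := UZ y.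
    by exists ord0.
  have ik : ((index i sq).+1 < (size sq).+1)%N by rewrite ltnS index_mem.
  exists (Ordinal ik) => //=; rewrite /lbl/= (nth_map i) ?index_mem//.
  by rewrite nth_index.
move=> l [V [ [oV Vcov] VU Vn] ].
have /choice[a aP] : forall j, exists o, V j `<=` U' (lbl o).
  by move=> j; have [k Vk] := VU j; exists k.
have lblsq j i : lbl j = Some i -> i \in sq.
  rewrite /lbl; case: j => [ [|j] jn]//= jE.
  by rewrite -(mem_map (@Some_inj _)) -jE mem_nth// size_map.
exists (fun i => \bigcup_(j in [set j | lbl (a j) = Some i]) V j); split.
- by move=> i; apply: bigcup_open => j _; exact: oV.
- by move=> i y [j /= ji]; move/aP; rewrite ji.
- move=> y nZy; have : [set: Y] y by [].
  rewrite -Vcov => -[j _ Vy]; have := aP j _ Vy.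
  case E: (lbl (a j)) => [i|//] Uy; exists i; first exact: lblsq E.
  by exists j.
- move=> y t ut tV; apply: leq_trans (Vn y).
  rewrite cardE; apply: leq_trans (_ : size (pmap (lbl \o a) (enum [set j : 'I_l | `[< V j y >] ]%SET)) <= _)%N; last first.
    by rewrite size_pmap; exact: count_size.
  apply: uniq_leq_size => // i /tV[j /= ji Vy].
  rewrite mem_pmap; apply/mapP; exists j => //.
  by rewrite mem_enum inE; exact/asboolP.
Qed.

(** The shrinking is performed on larger and larger parts [1 / p < s] of the
    space, the stage [p + 1] leaving the sets unchanged where the stage [p] has
    already bounded the order. *)
Lemma order_shrinking (I : eqType) (s : Y -> R) (U : I -> set Y) :
  continuous s -> (forall i, open (U i)) ->
  (forall y, 0 < s y -> exists i, U i y) ->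
  (forall r, 0 < r -> exists sq : seq I, forall i y, i \notin sq -> U i y -> s y < r) ->
  exists V : I -> set Y, [/\ forall i, open (V i), forall i, V i `<=` U i,
    forall y, 0 < s y -> exists i, V i y & forall y, 0 < s y -> order_le V y].
Proof.
move=> cs oU Ucov Ufin.
pose done p y := if p is p'.+1 then p'.+1%:R^-1 < s y else false.
have open_done p : open [set y | done p y].
  case: p => [|p].
    have -> : [set y | done 0%N y] = set0 by apply/seteqP; split=> y.
    exact: open0.
  by apply: (@open_comp _ _ s [set t | _ < t]) => [y _|]; [exact: cs|exact: open_gt].
pose good p (V : I -> set Y) := [/\ forall i, open (V i), forall i, V i `<=` U i,
  forall y, 0 < s y -> exists i, V i y & forall y, done p y -> order_le V y].
have /choice[step stepP] : forall pV : nat * (I -> set Y), exists V', good pV.1 pV.2 ->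
    [/\ good pV.1.+1 V', forall i, V' i `<=` pV.2 i
      & forall i y, done pV.1 y -> pV.2 i y -> V' i y].
  move=> [p V] /=; have [gV|ngV] := pselect (good p V); last by exists V.
  have [oV VU Vcov Vord] := gV.
  have p0 : 0 < p.+1%:R^-1 :> R by rewrite invr_gt0 ltr0n.
  have [sq sqP] := Ufin _ p0.
  have oZ : open [set y | s y < p.+1%:R^-1].
    by apply: (@open_comp _ _ s [set t | t < _]) => [y _|]; [exact: cs|exact: open_lt].
  have [|W [oW WV Wcov Word]] := finite_shrinking (sq := sq) oV oZ.
    move=> y; have [|ys] := ltP (s y) p.+1%:R^-1; first by left.
    have [i Vy] := Vcov _ (lt_le_trans p0 ys); right; exists i => //.
    apply/negPn/negP => /sqP /(_ (VU _ _ Vy)).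
    by rewrite ltNge ys.
  exists (fun i => (V i `&` [set y | done p y]) `|` W i `|` (V i `&` [set y | s y < p.+1%:R^-1])).
  move=> _; split.
  - split.
    + by move=> i; apply: openU; [apply: openU => //|]; exact: openI.
    + by move=> i y [ [ [/VU]|/WV/VU]|[/VU] ].
    + move=> y s0; have [ys|ys] := ltP (s y) p.+1%:R^-1.
        by have [i Vy] := Vcov _ s0; exists i; right.
      have [|i _ Wy] := Wcov y; first by apply/negP; rewrite -leNgt.
      by exists i; left; right.
    + move=> y /= ys; have [dy|ndy] := boolP (done p y) => t ut tV.
        by apply: (Vord y dy t ut) => i /tV[ [ [//]|/WV//]|[//] ].
      apply: (Word y t ut) => i /tV[ [ [_ /=]|//]|[_ /=] ].
        by rewrite (negbTE ndy).
      by rewrite ltNge (ltW ys).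
  - by move=> i y [ [ [//]|/WV//]|[//] ].
  - by move=> i y dy Vy; left; left.
pose V_ := fix V_ p := if p is p'.+1 then step (p', V_ p') else U.
have V_good p : good p (V_ p).
  elim: p => [|p IH]; first by split=> // y; rewrite /done.
  by have [] := stepP (p, V_ p) IH.
have V_sub p i : V_ p.+1 i `<=` V_ p i by have [_ + _] := stepP (p, V_ p) (V_good p); exact.
have V_keep p i y : done p y -> V_ p i y -> V_ p.+1 i y.
  by have [_ _] := stepP (p, V_ p) (V_good p); exact.
have done_mono p q y : (p <= q)%N -> done p y -> done q y.
  case: p q => [//|p] [//|q] /=; rewrite ltnS => pq; apply: le_lt_trans.
  by rewrite lef_pV2 ?posrE ?ltr0n// ler_nat ltnS.
have V_stable p q i y : done p y -> (p <= q)%N -> V_ q i y <-> V_ p i y.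
  move=> dy pq; rewrite -(subnKC pq); elim: (q - p)%N => [|k [IH1 IH2]]; first by rewrite addn0.
  rewrite addnS; split=> [/V_sub/IH1//|/IH2 Vy].
  by apply: V_keep => //; apply: done_mono dy; exact: leq_addr.
have doneE y : 0 < s y -> exists p, done p y.
  move=> y0; near \oo => p; exists p.+1; near: p; exact: near_infty_natSinv_lt (PosNum y0).
exists (fun i => \bigcup_p (V_ p i `&` [set y | done p y])); split.
- by move=> i; apply: bigcup_open => p _; apply: openI => //; case: (V_good p).
- by move=> i y [p _ [Vy _] ]; have [_ + _ _] := V_good p; apply; exact: Vy.
- move=> y y0; have [p dy] := doneE _ y0; have [_ _ /(_ _ y0)[i Vy] _] := V_good p.
  by exists i, p.
- move=> y y0 t ut tV; have [p dy] := doneE _ y0; have [_ _ _ /(_ _ dy)] := V_good p.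
  apply=> // i /tV[q _ [Vy /= dq] ]; have [pq|/ltnW qp] := leqP p q.
    exact/(V_stable _ _ _ _ dy pq).
  exact/(V_stable _ _ _ _ dq qp).
Unshelve. all: by end_near. Qed.

End Covers.

Section CoverFunctions.
Context {R : realType} (Y : topologicalType).
Hypotheses (hY : hausdorff_space Y) (lY : locally_compact [set: Y]).
Variable s : Y -> R.
Hypotheses (cs : continuous s) (sK : forall r, 0 < r -> compact [set y | r <= s y]).

(** The bands [m.+1%:R^-1 <= s], [m%:R * s <= 1] are compact, so finitely many of
    the sets [N y] with [y] in the band cover it; as [s] at most doubles on
    [N y], only the members chosen for finitely many bands meet [r <= s]. *)
Lemma small_cover (N : Y -> set Y) :
  (forall y, 0 < s y -> nbhs y (N y)) ->
  (forall y y', N y y' -> s y' <= 2 * s y) ->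
  exists U : Y -> set Y, [/\ forall y, open (U y), forall y, U y `<=` N y,
    forall y y', U y y' -> 0 < s y, forall y, 0 < s y -> exists z, U z y
    & forall r, 0 < r -> exists sq : seq Y, forall z y, z \notin sq -> U z y -> s y < r].
Proof.
move=> Nnbhs Ns.
pose band m := [set y | m.+1%:R^-1 <= s y] `&` [set y | m%:R * s y <= 1].
have inv0 m : 0 < m.+1%:R^-1 :> R by rewrite invr_gt0 ltr0n.
have cband m : compact (band m).
  apply: compact_closedI; first exact: sK.
  apply: (@closed_comp _ _ (fun y => m%:R * s y) [set t | t <= 1]); last exact: closed_le.
  by move=> y _; apply: cvgM; [exact: cvg_cst|exact: cs].
have /choice[c cP] : forall m, exists c : seq Y, (forall y, y \in c -> band m y) /\
    forall y, band m y -> exists2 z, z \in c & (N z)° y.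
  move=> m; have [y [y1 _]|c c1 c2] := compact_finite_cover (P := fun y => (N y)°) (cband m).
    by apply: nbhs_interior; apply: Nnbhs; exact: lt_le_trans y1.
  by exists c.
exists (fun z => [set y | (exists m, z \in c m) /\ (N z)° y]); split.
- move=> z; have [zc|nzc] := pselect (exists m, z \in c m).
    by rewrite (_ : mkset _ = (N z)°); [exact: open_interior|apply/seteqP; split=> y //= []].
  by rewrite (_ : mkset _ = set0); [exact: open0|apply/seteqP; split=> y //= []].
- by move=> z y [_ /interior_subset].
- move=> z y [ [m zm] _]; have [/(_ _ zm)[z1 _] _] := cP m.
  exact: lt_le_trans z1.
- move=> y y0; have [m ym] : exists m, band m y.
    exists (Num.truncn (s y)^-1).
    have /andP[m1 m2] := truncn_itv (ltW (etrans (invr_gt0 (s y)) y0)).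
    split; rewrite /=; first by rewrite -[leRHS]invrK lef_pV2 ?posrE ?ltr0n ?invr_gt0// ltW.
    by rewrite -ler_pdivlMr// mul1r.
  have [_ /(_ _ ym)[z zc Ny]] := cP m; exists z; split=> //.
  by exists m.
- move=> r r0; have [M Mr] : exists M : nat, M.+1%:R^-1 < r / 2.
    near \oo => M; exists M; near: M.
    exact: near_infty_natSinv_lt (PosNum (divr_gt0 r0 (ltr0n R 2))).
  exists (flatten [seq c m | m <- iota 0 M.+1]) => z y nz [ [m zm] /interior_subset Nz].
  have [/(_ _ zm)[_ /= mz] _] := cP m.
  have Mm : (M < m)%N.
    rewrite ltnNge; apply: contra nz => mM; apply/flattenP; exists (c m) => //.
    by apply/mapP; exists m => //; rewrite mem_iota.
  apply: le_lt_trans (Ns _ _ Nz) _; rewrite mulrC -ltr_pdivlMr//.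
  have m0 : (0 < m)%N by exact: leq_ltn_trans Mm.
  apply: le_lt_trans Mr; apply: (@le_trans _ _ m%:R^-1).
    by rewrite -[leRHS]mul1r ler_pdivlMr ?ltr0n// mulrC.
  by rewrite lef_pV2 ?posrE ?ltr0n// ler_nat.
Unshelve. all: by end_near. Qed.

(** On each compact set [m.+1%:R^-1 <= s] finitely many bump functions suffice,
    grouped according to the member of the cover that contains their support;
    [cozero_bigcup] combines the countably many stages. The nerve map being
    homogeneous, the sum need not be [1]. *)
Lemma cover_functions (I : eqType) (V : I -> set Y) :
  (forall i, open (V i)) -> (forall y, 0 < s y -> exists i, V i y) ->
  exists mu : I -> Y -> R, [/\ forall i, continuous (mu i), forall i y, 0 <= mu i y,
    forall i y, 0 < mu i y -> V i y & forall y, 0 < s y -> exists i, 0 < mu i y].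
Proof.
move=> oV Vcov.
have /choice[h hP] : forall m, exists h : I -> Y -> R, [/\ forall i, continuous (h i),
    forall i y, 0 <= h i y, forall i y, 0 < h i y -> V i y
    & forall y, m.+1%:R^-1 <= s y -> exists i, 0 < h i y].
  move=> m; have m0 : 0 < m.+1%:R^-1 :> R by rewrite invr_gt0 ltr0n.
  have [[y0 y0s]|no] := pselect (exists y, m.+1%:R^-1 <= s y); last first.
    exists (fun _ _ => 0); split=> [i y|//|i y|y ys].
    - exact: cvg_cst.
    - by rewrite ltxx.
    - by case: no; exists y.
  have [i0 _] := Vcov _ (lt_le_trans m0 y0s).
  have /choice[bi biP] : forall y, exists bi : (Y -> R) * I,
      [/\ continuous bi.1, forall t, 0 <= bi.1 t, 0 < s y -> 0 < bi.1 y
        & forall t, 0 < bi.1 t -> V bi.2 t].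
    move=> y; have [ys|ys] := ltP 0 (s y); last first.
      exists (fun=> 0, i0); split=> [t|t||t] /=.
      - exact: cvg_cst.
      - by [].
      - by [].
      - by rewrite ltxx.
    have [i Vi] := Vcov _ ys.
    have [b [cb b01 by1 bV]] := @locally_compact_bump R Y y (V i) lY hY (oV i) Vi.
    exists (b, i); split=> //= [t|_]; first by have /andP[] := b01 t.
    by rewrite by1.
  have [y ys|c _ cP] := compact_finite_cover (P := fun y => [set t | 0 < (bi y).1 t]) (sK m0).
    have [cb _ b0 _] := biP y; apply: (cvgr_gt _ (cb y)); apply: b0.
    exact: lt_le_trans ys.
  exists (fun i t => \sum_(y <- c | (bi y).2 == i) (bi y).1 t); split.
  - move=> i; apply: continuous_big => [|y _]; first exact: add_continuous.
    by have [] := biP y.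
  - by move=> i t; apply: sumr_ge0 => y _; have [] := biP y.
  - move=> i t; apply: contraPP => nVt; apply/negP; rewrite -leNgt.
    apply: sumr_le0 => y /eqP yi; rewrite leNgt; apply/negP => bt.
    by apply: nVt; rewrite -yi; have [_ _ _] := biP y; apply.
  - move=> y ys; have [z zc bz] := cP y ys; exists (bi z).2.
    rewrite (big_rem z)//= eqxx ltr_wpDr// sumr_ge0// => t _.
    by have [] := biP t.
have /choice[mu muP] : forall i, exists mu : Y -> R, [/\ continuous mu,
    forall t, 0 <= mu t & forall t, 0 < mu t <-> exists m, 0 < h m i t].
  by move=> i; apply: cozero_bigcup => m; have [] := hP m.
exists mu; split.
- by move=> i; have [] := muP i.
- by move=> i; have [] := muP i.
- by move=> i y; have [_ _ ->] := muP i => -[m]; have [_ _ + _] := hP m; apply.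
- move=> y y0; have [m my] : exists m, m.+1%:R^-1 < s y.
    near \oo => m; exists m; near: m; exact: near_infty_natSinv_lt (PosNum y0).
  have [_ _ _ /(_ y (ltW my))[i hi]] := hP m; exists i.
  by have [_ _ ->] := muP i; exists m.
Unshelve. all: by end_near. Qed.

End CoverFunctions.

(** * Controlled extension *)

Section ControlledExtension.
Context {R : realType} (n : nat) (W : topologicalType) (e : W -> nat -> R) (X : set W).

Lemma near_all_seq (T : Type) (F : set_system T) {FF : Filter F} (I : eqType) (sq : seq I)
    (P : I -> T -> Prop) :
  (forall i, i \in sq -> \forall t \near F, P i t) ->
  \forall t \near F, forall i, i \in sq -> P i t.
Proof.
elim: sq => [|i sq IH] sqP; first by apply: nearW => t i.
have Pi : \forall t \near F, P i t by apply: sqP; rewrite mem_head.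
have Psq : \forall t \near F, forall j, j \in sq -> P j t.
  by apply: IH => j js; apply: sqP; rewrite inE js orbT.
by apply: filterS2 Pi Psq => t Pit Psqt j; rewrite inE => /orP[/eqP->//|/Psqt].
Qed.

(** The dimension of [Y] gives a cover of [0 < s], of order at most [n + 1], by
    open sets on which [s] and [F] vary little compared with [s]. Label each
    member by a point of [W] close to the values of [F] there; [nerve_map] sends
    the nerve into [X], and composing with functions subordinate to the cover
    gives [g] on [0 < s]. Where [s] tends to [0] and [F] to [W] the displacement
    tends to [0], so [g] is continuous together with its values on [s = 0].
    The modulus does not depend on [Y], [F] and [s]. *)
Theorem controlled_extension (w0 : W) :
  seq_embedding e -> relAE R n X -> relLC R n X ->
  exists2 theta : R -> R, modulus theta &
  forall Y : topologicalType,
    hausdorff_space Y -> locally_compact [set: Y] -> covering_dim_le Y n ->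
  forall (F : Y -> nat -> R) (s : Y -> R),
    (forall i, continuous (F^~ i)) -> continuous s -> (forall y, 0 <= s y) ->
    (forall r, 0 < r -> compact [set y | r <= s y]) ->
    (forall y, s y = 0 -> exists w, e w = F y) ->
  exists g : Y -> W, [/\ continuous g, forall y, s y = 0 -> e (g y) = F y,
    forall y, 0 < s y -> X (g y)
    & forall y, 0 < s y ->
        seqdist (e (g y)) (F y) <= theta (s y + setdist (range e) (F y))].
Proof.
move=> eW aeX lcX; have [zeta mz zetaP] := relLC_modulus eW aeX lcX.
pose eta := skeleton_modulus zeta n.+1.
have meta : modulus eta by exact: skeleton_modulusP.
have me24 : modulus (fun a => eta (24 * a)).
  apply: (@modulus_comp _ eta (fun a => 24 * a)) => //; first exact: modulusM.
  by move=> a a0; rewrite mulr_gt0.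
exists (fun a => 8 * a + eta (24 * a)); first by apply: modulusD => //; exact: modulusM.
move=> Y hY lY dimY F s cF cs s0 sK sF.
pose dW y := setdist (range e) (F y).
have W0 : range e !=set0 by exists (e w0), w0.
have cdW : continuous dW by exact: continuous_setdist.
have dWlip y y' : dW y' <= dW y + seqdist (F y) (F y') by exact: setdist_lip.
(* On [N y] the function [s] stays between [s y / 2] and [3 * s y / 2]. *)
pose N y := [set y' | `|s y - s y'| < s y / 2 /\ seqdist (F y) (F y') < s y / 8].
have [|y y' [+ _]|U [oU UN Us Ucov Ufin]] := small_cover cs sK (N := N).
- move=> y y0; apply: filterI.
    by apply: (@cvgr_dist_lt _ _ _ _ _ _ _ (cs y)); rewrite divr_gt0.
  have y80 : 0 < s y / 8 / 2 by rewrite !divr_gt0.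
  apply: filterS (seqdist_cvg (fun i => cF i y) y80) => y' h.
  by apply: le_lt_trans h _; rewrite ltr_pdivrMr// ltr_pMr ?divr_gt0// ltr1n.
- by rewrite ltr_norml => /andP[? ?]; have := s0 y'; lra.
have [V [oV VU Vcov Vord]] := order_shrinking dimY cs oU Ucov Ufin.
have [mu [cmu mu0 muV mucov]] := cover_functions hY lY sK oV Vcov.
have VN z y : V z y -> [/\ 0 < s z, `|s z - s y| < s z / 2 & seqdist (F z) (F y) < s z / 8].
  by move=> /VU Uzy; have [? ?] := UN _ _ Uzy; split=> //; exact: Us Uzy.
have /choice[w wP] : forall z, exists w, 0 < s z -> seqdist (F z) (e w) < dW z + s z.
  move=> z; have [z0|z0] := ltP 0 (s z); last by exists w0.
  have [|_ [w _ <-] ?] := @setdist_lt R (range e) (F z) (dW z + s z) W0.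
    by rewrite ltrDl.
  by exists w.
(* The scale of the vertex [z]: it exceeds the distance from the label of [z] to
   the label of any member of the cover that meets [V z]. *)
pose r z := 6 * (s z + dW z).
pose nerve (S : {fset Y}) := exists2 y, 0 < s y & forall i, i \in S -> V i y.
have near_r z y : V z y -> [/\ s z < 2 * s y, 2 * s y < 3 * s z, dW z <= dW y + s z / 8
    & dW y <= dW z + s z / 8].
  move=> /VN[z0]; rewrite ltr_norml => /andP[? ?] Fzy.
  have := dWlip z y; have := dWlip y z; rewrite (seqdistC (F y)) => h1 h2.
  by split; lra.
have [||S i j [y y0 SV] iS jS|G [GC GX]] := nerve_map (W := W) mz zetaP w0 (N := nerve) (w := w) (r := r).
- by move=> S T /fsubsetP ST [y y0 TV]; exists y => // i /ST; exact: TV.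
- by move=> S [y y0 SV]; apply: (Vord y y0) => //; exact: fset_uniq.
- have [iy1 iy2 iy3 iy4] := near_r _ _ (SV i iS); have [jy1 jy2 jy3 jy4] := near_r _ _ (SV j jS).
  have [i0 _ Fi] := VN _ _ (SV i iS); have [j0 _ Fj] := VN _ _ (SV j jS).
  have di0 : 0 <= dW i := setdist_ge0 _ _; have dj0 : 0 <= dW j := setdist_ge0 _ _.
  have wi := wP i i0; have wj := wP j j0.
  split; rewrite /r; [lra|lra|].
  have h1 := seqdist_triangle (F i) (e (w i)) (e (w j)).
  have h2 := seqdist_triangle (F y) (F i) (e (w j)).
  have h3 := seqdist_triangle (F j) (F y) (e (w j)).
  rewrite (seqdistC (e (w i)) (F i)) in h1; rewrite (seqdistC (F y) (F j)) in h3.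
  lra.
have /choice[g gP] : forall y, exists w, (0 < s y -> w = G (mu^~ y)) /\
    (s y = 0 -> e w = F y).
  move=> y; have [y0|] := ltP 0 (s y).
    by exists (G (mu^~ y)); split=> // ys; rewrite ys ltxx in y0.
  move=> y0; have ys : s y = 0 by apply/eqP; rewrite eq_le y0 s0.
  by have [w' w'F] := sF y ys; exists w'; split=> // /lt_geF; rewrite y0.
have gG y : 0 < s y -> g y = G (mu^~ y) by case: (gP y) => + _; apply.
have gF y : s y = 0 -> e (g y) = F y by case: (gP y) => _; apply.
have Vfin d : 0 < d -> exists sq : seq Y, forall i y, d <= s y -> V i y -> i \in sq.
  move=> /Ufin[sq sqP]; exists sq => i y dy /VU Uy; apply/negPn/negP => /sqP /(_ Uy).
  by rewrite ltNge dy.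
have cone_mu (sq : seq Y) y : 0 < s y -> (forall i, V i y -> i \in sq) ->
    cone [fset i in sq | 0 < mu i y]%fset (mu^~ y).
  move=> y0 sqV; split=> [//|i mi|]; last exact: mucov.
  by rewrite !inE/= mi andbT; apply: sqV; exact: muV.
have nerve_mu (sq : seq Y) y : 0 < s y -> nerve [fset i in sq | 0 < mu i y]%fset.
  by move=> y0; exists y => // i; rewrite !inE/= => /andP[_]; exact: muV.
have gclose y : 0 < s y -> X (g y) /\
    seqdist (e (g y)) (F y) <= 8 * (s y + dW y) + eta (24 * (s y + dW y)).
  move=> y0; have [sq sqV] := Vfin _ y0; rewrite gG//.
  have [i mi] := mucov _ y0.
  have iS : i \in [fset i in sq | 0 < mu i y]%fset.
    by rewrite !inE/= mi andbT; apply: sqV (muV _ _ mi).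
  have [Xg wg] := GX _ _ _ (nerve_mu sq y y0) (cone_mu sq y y0 (fun i => sqV i y (lexx _))) iS.
  split=> //; have [iy1 iy2 iy3 iy4] := near_r _ _ (muV _ _ mi).
  have [i0 _ Fi] := VN _ _ (muV _ _ mi); have wi := wP i i0.
  have di0 : 0 <= dW i := setdist_ge0 _ _; have dy0 : 0 <= dW y := setdist_ge0 _ _.
  have eta24 : eta (r i) <= eta (24 * (s y + dW y)).
    by case: meta => + _ _; apply; rewrite /r; lra.
  have h1 := seqdist_triangle (e (w i)) (e (G (mu^~ y))) (F y).
  have h2 := seqdist_triangle (F i) (e (w i)) (F y).
  rewrite (seqdistC _ (e (w i))) in h1; rewrite (seqdistC (e (w i)) (F i)) in h2.
  have wg' : seqdist (e (w i)) (e (G (mu^~ y))) <= eta (r i) := wg.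
  lra.
exists g; split=> //; [|by move=> y /gclose[]|by move=> y /gclose[]].
move=> y; have [y0|ny0] := ltP 0 (s y); last first.
  (* At points of [s = 0] continuity comes from the estimate [gclose]. *)
  have ys : s y = 0 by apply/eqP; rewrite eq_le ny0 s0.
  have dy : dW y = 0 by apply: setdist0; have [v <-] := sF y ys; exists v.
  apply: (seq_embedding_cvg eW) => d d0; rewrite (gF _ ys).
  have d40 : 0 < d / 4 by rewrite divr_gt0.
  have [a a0 ad] : exists2 a, 0 < a & forall b, 0 < b -> b < a -> 8 * b + eta (24 * b) <= d / 4.
    have [_ _] : modulus (fun a => 8 * a + eta (24 * a)).
      by apply: modulusD => //; exact: modulusM.
    by move/(_ _ d40).
  have csd : continuous (fun y => s y + dW y).
    by move=> t; apply: cvgD; [exact: cs|exact: cdW].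
  have na : \forall y' \near y, s y' + dW y' < a.
    by apply: (cvgr_lt _ (csd y)); rewrite ys dy addr0.
  apply: filterS2 na (seqdist_cvg (fun i => cF i y) d40) => y' y'a Fy'.
  have [y'0|y'0] := ltP 0 (s y').
    have [_ gy'] := gclose _ y'0.
    have h := seqdist_triangle (F y') (F y) (e (g y')).
    have sa : 0 < s y' + dW y' by rewrite ltr_wpDr// setdist_ge0.
    have := ad _ sa y'a; rewrite (seqdistC (F y')) in h; lra.
  rewrite gF; last by apply/eqP; rewrite eq_le y'0 s0.
  lra.
(* At points of [0 < s] only finitely many members of the cover matter nearby,
   hence finitely many faces, on each of which [G] is continuous. *)
have y20 : 0 < s y / 2 by rewrite divr_gt0.
have [sq sqV] := Vfin _ y20.
pose S0 := [fset i in sq | 0 < mu i y]%fset.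
have coneS0 : cone S0 (mu^~ y).
  by apply: cone_mu => // i; apply: sqV; rewrite ler_pdivrMr// ler_peMr ?ler1n// ltW.
move=> O; rewrite gG// => Oy; near_simpl.
have near_s : \forall y' \near y, s y / 2 < s y'.
  by apply: (cvgr_gt _ (cs y)); rewrite ltr_pdivrMr// ltr_pMr// ltr1n.
have near_mu : \forall y' \near y, forall i, i \in sq -> 0 < mu i y -> 0 < mu i y'.
  apply: near_all_seq => i _; have [mi|mi] := ltP 0 (mu i y); last exact: nearW.
  by apply: filterS (cvgr_gt _ (cmu i y) _ mi).
pose L : {fset Y} := [fset i in sq]%fset.
have near_G : \forall y' \near y, forall S, S \in enum_fset (fpowerset L) ->
    nerve S -> cone S (mu^~ y) -> cone S (mu^~ y') -> O (G (mu^~ y')).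
  apply: near_all_seq => S _; have [nS|nnS] := pselect (nerve S); last exact: nearW.
  have [cS|ncS] := pselect (cone S (mu^~ y)); last exact: nearW.
  have := GC S nS Y [set y' | cone S (mu^~ y')] (fun y' i => mu i y').
  move=> /(_ (fun i => continuous_subspaceT (cmu i)))/(_ (fun _ => id)).
  move=> /subspace_continuousP/(_ y cS)/(_ O Oy) h.
  have {}h : \forall y' \near y, cone S (mu^~ y') -> O (G (mu^~ y')) by exact: h.
  by apply: filterS h => y' h _ _; exact: h.
apply: filterS3 near_s near_mu near_G => y' y's mu' GO.
have y'0 : 0 < s y' by exact: lt_trans y's.
rewrite gG//; apply: (GO [fset i in sq | 0 < mu i y']%fset).
- by rewrite fpowersetE; apply/fsubsetP => i; rewrite !inE/= => /andP[].
- exact: nerve_mu.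
- apply: coneS coneS0; apply/fsubsetP => i; rewrite !inE/= => /andP[isq mi].
  by rewrite isq mu'.
- by apply: cone_mu => // i; apply: sqV; exact: ltW.
Qed.

End ControlledExtension.

(** * Dimension of the cube *)

Section CubeMetric.
Context {R : realType} {n : nat}.
Local Notation C := (cube R n).

Let dist (z z' : C) : R := `|set_val z - set_val z'|.

Let dist_ge0 z z' : 0 <= dist z z'. Proof. exact: normr_ge0. Qed.

Let dist_positivity z z' : dist z z' = 0 -> z = z'.
Proof. by move/normr0_eq0/eqP; rewrite subr_eq0 => /eqP/val_inj. Qed.

Let ballEdist z d : ball z d = [set z' | dist z z' < d].
Proof. by rewrite -initial_ballE -ball_normE. Qed.

(* The topology and the balls are those of the subspace, so that maps on
   [cube_metric R n] are maps on [cube R n]. *)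
HB.instance Definition _ := @PseudoMetric_isMetric.Build R
  (set_type [set x : 'rV[R]_n | forall i, `|x ord0 i| <= 1])
  dist dist_ge0 dist_positivity ballEdist.

Definition cube_metric : metricType R :=
  set_type [set x : 'rV[R]_n | forall i, `|x ord0 i| <= 1].
End CubeMetric.

Lemma sigma_compact_lindelof (Y : topologicalType) (K : nat -> set Y) :
  (forall m, compact (K m)) -> (forall y, exists m, K m y) -> lindelof Y.
Proof.
move=> cK Kcov U Uo Ucov.
have /choice[q qP] : forall y, exists Z, U Z /\ Z y.
  by move=> y; have : [set: Y] y by []; rewrite -Ucov => -[Z UZ Zy]; exists Z.
have /choice[s sP] : forall m, exists s : seq Y, forall y, K m y ->
    exists2 x, x \in s & q x y.
  move=> m; have [y _|s _ sP] := compact_finite_cover (P := q) (cK m); last by exists s.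
  by have [Uy qy] := qP y; apply: open_nbhs_nbhs; split=> //; exact: Uo.
exists (\bigcup_m (q @` [set` s m])); split.
- by move=> _ [m _ [y _ <-] ]; case: (qP y).
- apply: bigcup_countable => // m _; apply: finite_set_countable.
  exact: finite_image.
- apply/seteqP; split=> // y _; have [m Ky] := Kcov y.
  by have [x xs qxy] := sP m y Ky; exists (q x) => //; exists m => //; exists x.
Qed.

Lemma compact_lindelof (Y : topologicalType) : compact [set: Y] -> lindelof Y.
Proof. by move=> cY; apply: (@sigma_compact_lindelof Y (fun=> setT)) => // y; exists 0%N. Qed.

Lemma compact_locally_compact (Y : topologicalType) :
  compact [set: Y] -> locally_compact [set: Y].
Proof. by move=> cY y _; exists setT; [exact: filterT|split=> //; exact: closedT]. Qed.

Section CubeDimension.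
Context {R : realType} {n : nat}.
Local Notation C := (cube R n).
Local Notation T := (nat * C)%type.

Lemma cube_near (z : C) (r : R) : 0 < r ->
  \forall z' \near z, forall l, `|coord z l - coord z' l| < r.
Proof.
move=> r0; have FF := @nbhs_filter C z; apply: (@filter_forall C 'I_n (fun l z' => `|coord z l - coord z' l| < r) (nbhs z)) => l.
by have /cvgr_dist_lt := @cube_coord_continuous R n l z; apply.
Qed.

Lemma cube_nbhs (z : C) (V : set C) : nbhs z V ->
  exists2 r, 0 < r & forall z', (forall l, `|coord z l - coord z' l| < r) -> V z'.
Proof.
move=> /nbhs_ballP[r /= r0 rV]; exists r => // z' zz'; apply: rV.
by rewrite -initial_ballE; split=> // i l; rewrite (ord1 i); exact: zz'.
Qed.

Lemma slice_nbhs (j : nat) (z : C) (V : set C) :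
  nbhs z V -> nbhs ((j, z) : T) [set jz | jz.1 = j /\ V jz.2].
Proof.
move=> zV; exists ([set j], V); first by split=> //; exact: discrete_set1.
by move=> [j' z'] /= [-> ?].
Qed.

Lemma slice_continuous (j : nat) : continuous (fun z : C => (j, z) : T).
Proof.
move=> z V [ [A B] /= [jA zB] AB]; apply: filterS zB => z' Bz'; apply: AB.
by split=> //; exact: nbhs_singleton jA.
Qed.

Lemma slice_compact (j : nat) : compact [set jz : T | jz.1 = j].
Proof.
have -> : [set jz : T | jz.1 = j] = [set j] `*` [set: C].
  by apply/seteqP; split=> [ [j' z]|[j' z] ] /= => [->|[] ].
apply: compact_setX; [exact: compact_set1|exact: cube_compact].
Qed.

Lemma nat_cube_lindelof : lindelof T.
Proof.
apply: (@sigma_compact_lindelof _ (fun j => [set jz : T | jz.1 = j])).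
  exact: slice_compact.
by move=> [j z]; exists j.
Qed.

Lemma nat_cube_hausdorff : hausdorff_space T.
Proof.
move=> [j z] [j' z'] jz; have jj' : j = j'.
  have [ [k w] [/= [-> _] [-> _] ]//] := jz _ _ (slice_nbhs j (@filterT _ _ (nbhs_filter z)))
    (slice_nbhs j' (@filterT _ _ (nbhs_filter z'))).
congr pair => //; apply: (@cube_hausdorff R n) => V V' zV zV'.
have [ [k w] [/= [_ Vw] [_ V'w] ]] := jz _ _ (slice_nbhs j zV) (slice_nbhs j' zV').
by exists w.
Qed.

Lemma nat_cube_locally_compact : locally_compact [set: T].
Proof.
move=> [j z] _; exists [set jz : T | jz.1 = j]; last first.
  split; first exact: slice_compact.
  apply: compact_closed; [exact: nat_cube_hausdorff|exact: slice_compact].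
rewrite withinET; apply: filterS (slice_nbhs j (@filterT _ _ (nbhs_filter z))).
by move=> jz [].
Qed.

(** Kolmogorov's boxes: in units of [1 / N], the open boxes of colour [c] are the
    products of the intervals left between the gaps [[c + (n + 1) k, c + (n + 1) k + 1/2]],
    [k] an integer. Gaps of different colours are disjoint. *)
Definition box (N : nat) (c : 'I_n.+1) (m : 'I_n -> int) : set C :=
  [set z | forall l, 2^-1 < N%:R * coord z l - c%:R - n.+1%:R * (m l)%:~R < n.+1%:R].

Lemma box_near N c m z : box N c m z -> nbhs z (box N c m).
Proof.
move=> zb; have FF := @nbhs_filter C z.
apply: (@filter_forall C 'I_n (fun l z' => 2^-1 < N%:R * coord z' l - c%:R -
  n.+1%:R * (m l)%:~R < n.+1%:R) (nbhs z)) => l; have /andP[zl1 zl2] := zb l.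
pose f (z' : C) : R := N%:R * coord z' l - c%:R - n.+1%:R * (m l)%:~R.
have cf : {for z, continuous f}.
  apply: cvgB; [apply: cvgB|exact: cvg_cst]; last exact: cvg_cst.
  by apply: cvgM; [exact: cvg_cst|exact: cube_coord_continuous].
apply: filterS (filterI (cvgr_gt _ cf _ zl1) (cvgr_lt _ cf _ zl2)) => z' [h1 h2].
by apply/andP.
Qed.

Lemma box_small N c m z z' l :
  box N c m z -> box N c m z' -> N%:R * `|coord z l - coord z' l| < n.+1%:R.
Proof.
move=> /(_ l)/andP[z1 z2] /(_ l)/andP[z'1 z'2].
rewrite -[X in X * _](@ger0_norm R)// -normrM mulrBr ltr_norml.
by apply/andP; split; lra.
Qed.

Lemma box_inj N c m m' z : box N c m z -> box N c m' z -> m = m'.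
Proof.
move=> zm zm'; apply/funext => l; have /andP[z1 z2] := zm l; have /andP[z'1 z'2] := zm' l.
have n0 : 0 < n.+1%:R :> R by rewrite ltr0n.
have d : `|(m l - m' l)%:~R : R| < 1.
  rewrite -(ltr_pM2l n0) mulr1 -[X in X * _](@ger0_norm R) ?ler0n// -normrM rmorphB/= mulrBr.
  by rewrite ltr_norml; apply/andP; split; lra.
by rewrite -intr_norm ltrz1 in d; lia.
Qed.

(** Each of the [n] coordinates lies in a gap of at most one of the [n + 1]
    colours, so some colour has no gap at any coordinate. *)
Lemma box_cover N (z : C) : exists c m, box N c m z.
Proof.
have p0 : 0 < n.+1%:R :> R by rewrite ltr0n.
pose m (c : 'I_n.+1) (l : 'I_n) : int := Num.floor ((N%:R * coord z l - c%:R) / n.+1%:R).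
have mP (c : 'I_n.+1) l : 0 <= N%:R * coord z l - c%:R - n.+1%:R * (m c l)%:~R < n.+1%:R.
  have /andP[] := floor_itv ((N%:R * coord z l - c%:R) / n.+1%:R).
  rewrite -/(m c l) ler_pdivlMr// ltr_pdivrMr// intrD mulrDl mul1r => h1 h2.
  by rewrite [n.+1%:R * _]mulrC; apply/andP; split; lra.
apply: contrapT => /forallNP nb.
have /choice[f fP] : forall c : 'I_n.+1, exists l, N%:R * coord z l - c%:R - n.+1%:R * (m c l)%:~R <= 2^-1.
  move=> c; apply: contrapT => /forallNP ngap; apply: (nb c); exists (m c) => l.
  by have /andP[_ ->] := mP c l; rewrite andbT ltNge; apply/negP; exact: ngap.
have : ~ injective f by move=> /leq_card; rewrite !card_ord ltnn.
apply=> c c' ff; have := fP c; have := fP c'; rewrite -ff.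
have /andP[h1 _] := mP c (f c); have /andP[h1' _] := mP c' (f c) => h2' h2.
have d : `|(c%:Z - c'%:Z + n.+1%:Z * (m c (f c) - m c' (f c)))%:~R : R| < 1.
  rewrite rmorphD rmorphB/= rmorphM/= rmorphB/= ltr_norml.
  by apply/andP; split; lra.
rewrite -intr_norm ltrz1 in d; apply: val_inj => /=.
have cn := ltn_ord c; have cn' := ltn_ord c'.
have : (c%:Z - c'%:Z + n.+1%:Z * (m c (f c) - m c' (f c))) = 0 by lia.
move: (m c (f c) - m c' (f c)) => q eq0.
have [q0|q0|q0] := ltrgtP q 0; last by rewrite q0 mulr0 in eq0; lia.
  have : n.+1%:Z * (q + 1) <= 0 by rewrite mulr_ge0_le0//; lia.
  lia.
have : 0 <= n.+1%:Z * (q - 1) by rewrite mulr_ge0//; lia.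
lia.
Qed.

(** On the slice [j] the boxes at a sufficiently fine scale refine the cover; merging
    the boxes of one colour that are sent to the same member of the cover leaves
    finitely many open sets over all slices, and at most one of each colour
    contains a given point. *)
Lemma nat_cube_dim : covering_dim_le T n.
Proof.
move=> k U [oU Ucov].
have Uex jz : exists i, U i jz by have : [set: T] jz by []; rewrite -Ucov => -[i _ ?]; exists i.
have /choice[M MP] : forall j, exists M : nat, forall z, exists i : 'I_k, forall z',
    (forall l, M%:R * `|coord z l - coord z' l| < 1) -> U i (j, z').
  move=> j.
  have /choice[r rP] : forall z, exists r, 0 < r /\ exists i : 'I_k, forall z' : C,
      (forall l, `|coord z l - coord z' l| < r) -> U i (j, z').
    move=> z; have [i Uz] := Uex (j, z).
    have [|r r0 rU] := @cube_nbhs z [set z' | U i (j, z')].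
      by apply: (@slice_continuous j z (U i)); apply: open_nbhs_nbhs.
    by exists r; split=> //; exists i.
  have [z _|s _ sP] := compact_finite_cover
      (P := fun z => [set z' | forall l, `|coord z l - coord z' l| < r z / 2]) (@cube_compact R n).
    by apply: cube_near; rewrite divr_gt0//; case: (rP z).
  have [M Ms] : exists M : nat, forall z, z \in s -> 2 < M%:R * r z.
    elim: s {sP} => [|a s [M Ms] ]; first by exists 0%N.
    have [a0 _] := rP a.
    exists (maxn M (Num.truncn (2 / r a)).+1) => z; rewrite inE => /orP[/eqP->|/Ms].
      rewrite -ltr_pdivrMr//; apply: lt_le_trans (truncnS_gt _) _.
      by rewrite ler_nat leq_maxr.
    have [z0 _] := rP z; move/lt_le_trans; apply.
    by rewrite ler_pM2r// ler_nat leq_maxl.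
  exists M => z; have [//|a a_s az] := sP z; have [a0 [i iU] ] := rP a.
  exists i => z' zz'; apply: iU => l.
  have Mr := Ms a a_s; have M0 : 0 < M%:R :> R.
    by rewrite -(pmulr_lgt0 _ a0); apply: lt_trans Mr.
  have := zz' l; rewrite mulrC -ltr_pdivlMr// => zl.
  have Mi : 1 / M%:R < r a / 2 by rewrite ltr_pdivrMr// mulrAC ltr_pdivlMr// mul1r mulrC.
  have := ler_distD (coord z l) (coord a l) (coord z' l); have := az l.
  lra.
pose N j := (n.+1 * M j)%N.
have /choice[sel selP] : forall jcm : nat * 'I_n.+1 * ('I_n -> int), exists i : 'I_k,
    forall z, box (N jcm.1.1) jcm.1.2 jcm.2 z -> U i (jcm.1.1, z).
  move=> [ [j c] m] /=; have [ [z zb]|nb] := pselect (exists z, box (N j) c m z); last first.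
    have [i _] := Uex (0%N, to_cube (fun=> 0)); exists i => z zb; case: nb.
    by exists z.
  have [i iU] := MP j z; exists i => z' z'b; apply: iU => l.
  have := box_small l zb z'b; rewrite /N natrM -mulrA -[ltRHS]mulr1.
  by rewrite ltr_pM2l// ltr0n.
pose V (ic : 'I_k * 'I_n.+1) := [set jz : T | exists m,
  box (N jz.1) ic.2 m jz.2 /\ sel (jz.1, ic.2, m) = ic.1].
exists #|{: 'I_k * 'I_n.+1}|, (fun q => V (enum_val q)); split.
- split=> [q|].
    rewrite openE => -[j z] /= [m [/box_near zb sm] ].
    apply: filterS (slice_nbhs j zb) => -[_ z'] /= [-> z'b].
    by exists m.
  apply/seteqP; split=> // -[j z] _; have [c [m zb] ] := box_cover (N j) z.
  exists (enum_rank (sel (j, c, m), c)) => //; rewrite /= enum_rankK.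
  by exists m.
- move=> q; exists (enum_val q).1 => -[j z] [m [zb <-] ].
  exact: (selP (j, (enum_val q).2, m)).
- move=> [j z]; rewrite -(card_in_imset (f := fun q => (enum_val q).2)).
    by rewrite -[X in (_ <= X)%N](card_ord n.+1) max_card.
  move=> q q'; rewrite !inE => -[m [zb sm] ] [m' [zb' sm'] ] cc'.
  apply: enum_val_inj; rewrite [LHS]surjective_pairing [RHS]surjective_pairing cc'.
  congr pair; rewrite -sm -sm' /=; rewrite cc' in zb *.
  by rewrite (box_inj zb zb').
Qed.

Lemma cube_dim : covering_dim_le C n.
Proof.
move=> k U [oU Ucov].
have [] := @nat_cube_dim k (fun i => [set jz : T | U i jz.2]).
  split=> [i|].
    by apply: (@open_comp _ _ (snd : T -> C) (U i)) => // jz _; exact: cvg_snd.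
  apply/seteqP; split=> // jz _; have : [set: C] jz.2 by [].
  by rewrite -Ucov => -[i _ ?]; exists i.
move=> l [V [ [oV Vcov] VU Vn] ].
exists l, (fun j => [set z | V j (0%N, z)]); split=> [|j|z].
- split=> [j|].
    apply: (@open_comp _ _ (fun z : C => (0%N, z) : T) (V j)) => // z _.
    exact: slice_continuous.
  apply/seteqP; split=> // z _; have : [set: T] (0%N, z) by [].
  by rewrite -Vcov => -[j _ ?]; exists j.
- by have [i Vi] := VU j; exists i => z /Vi.
- exact: Vn.
Qed.

End CubeDimension.

Arguments cube_metric : clear implicits.

(** * Extending maps from the cube *)

Section Subtypes.
Variables (T : topologicalType) (A : set T).

Lemma set_type_val_continuous : continuous (set_val : set_type A -> T).
Proof. exact: initial_continuous. Qed.

Lemma set_type_nbhs (a : set_type A) (V : set (set_type A)) : nbhs a V ->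
  exists2 Z, nbhs (set_val a) Z & forall b, Z (set_val b) -> V b.
Proof.
by move=> [_ [/= [Z oZ <-] /= Za] ZV]; exists Z => //; exact: open_nbhs_nbhs.
Qed.

Lemma set_type_compact (K : set T) (S : set (set_type A)) :
  closed A -> closed S -> compact K -> (forall a, S a -> K (set_val a)) -> compact S.
Proof.
move=> cA cS cK SK F PF FS.
have FK : F (set_val @^-1` K) by apply: filterS FS => a; exact: SK.
have [x [Kx xF] ] := cK (set_val @ F) (fmap_proper_filter _ PF) FK.
have Ax : A x.
  apply: cA => Z xZ; have FA : F (set_val @^-1` A).
    by apply: filterS FS => a _; exact: (set_valP a).
  by have [y [? ?] ] := xF _ _ FA xZ; exists y.
pose a : set_type A := exist (fun x => x \in A) x (mem_set Ax).
have aF : cluster F a.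
  move=> B V FB /set_type_nbhs[Z xZ ZV].
  have FB' : F (set_val @^-1` (set_val @` B)) by apply: filterS FB => b Bb; exists b.
  by have [_ [ [b Bb <-] Zb] ] := xF _ _ FB' xZ; exists b; split=> //; exact: ZV.
exists a; split=> //; apply: cS => V aV.
by have [b [? ?] ] := aF _ _ FS aV; exists b.
Qed.

End Subtypes.

Section ExtensorsOnCubes.
Context {R : realType} {n : nat}.
Local Notation C := (cube R n).

Lemma AE_relAE (K : topologicalType) : AE R n K -> relAE R n [set: K].
Proof.
move=> [_ _ aeK] B phi cB cphi _.
have cf : continuous (sigL B phi) by apply/subspace_sigL_continuousP.
have [||g cg gphi] := aeK (cube_metric R n) _ _ cube_dim B (sigL B phi) cB cf.
- by apply: compact_locally_compact; exact (cube_compact R n).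
- by apply: compact_lindelof; exact (cube_compact R n).
exists g; split=> // z Bz.
by rewrite -[z]/(set_val (exist (fun x => x \in B) z (mem_set Bz))) gphi.
Qed.

Lemma proper_compact_domain (K : topologicalType) (A : set C) (f : set_type A -> K) :
  hausdorff_space K -> closed A -> continuous f -> proper_map f.
Proof.
move=> hK cA cf; split=> // S cS.
apply: (@set_type_compact _ A setT) => //; last exact (cube_compact R n).
by apply: closed_comp (compact_closed hK cS) => a _; exact: cf.
Qed.

(** Extend the empty map, over the cube. *)
Lemma AEp_nonempty (X : topologicalType) : AEp n X -> exists x : X, True.
Proof.
move=> [hX _ aeX]; have noA (a : set_type (set0 : set C)) : False := set_valP a.
pose f (a : set_type (set0 : set C)) : X := match noA a with end.
have [||||g _ _] := aeX C (@cube_hausdorff R n) _ _ cube_dim set0 f.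
- by apply: compact_locally_compact; exact (cube_compact R n).
- by apply: compact_lindelof; exact (cube_compact R n).
- exact: closed0.
- by apply: proper_compact_domain => //; exact: closed0.
by exists (g (to_cube (fun=> 0))).
Qed.

Lemma AE_nonempty (K : topologicalType) : AE R n K -> exists k : K, True.
Proof.
move=> [_ _ aeK]; have noA (a : set_type (set0 : set C)) : False := set_valP a.
pose f (a : set_type (set0 : set C)) : K := match noA a with end.
have [||||g _ _] := aeK (cube_metric R n) _ _ cube_dim set0 f.
- by apply: compact_locally_compact; exact (cube_compact R n).
- by apply: compact_lindelof; exact (cube_compact R n).
- exact: closed0.
- by move=> a; case: (noA a).
by exists (g (to_cube (fun=> 0))).
Qed.

Lemma some_continuousP (X : topologicalType) (T : topologicalType) (f : T -> X) :
  continuous (fun t => Some (f t) : one_point_compactification X) -> continuous f.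
Proof.
move=> cf t V fV.
have h := cf t _ (@one_point_compactification_some_nbhs X (f t) V fV).
have {}h : nbhs t [set t' | (Some @` V) (Some (f t'))] by exact: h.
by apply: filterS h => t' [x Vx [xf] ]; rewrite /= -xf.
Qed.

Lemma AEp_relAE (X : topologicalType) : AEp n X ->
  relAE R n (range (Some : X -> one_point_compactification X)).
Proof.
move=> aeX; have [x0 _] := AEp_nonempty aeX; have [hX _ ae] := aeX.
move=> B phi cB cphi phiX; pose f (a : set_type B) : X := odflt x0 (phi (set_val a)).
have Sf a : Some (f a) = phi (set_val a).
  by have [ [x _ xa] _] := phiX _ (set_valP a); rewrite /f set_valE -xa.
have cf : continuous f.
  apply: some_continuousP; rewrite (_ : (fun _ => _) = sigL B phi).
    by apply/subspace_sigL_continuousP.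
  by apply/funext => a; rewrite Sf.
have [||||g [cg _] gf] := ae C (@cube_hausdorff R n) _ _ cube_dim B f.
- by apply: compact_locally_compact; exact (cube_compact R n).
- by apply: compact_lindelof; exact (cube_compact R n).
- exact: cB.
- exact: proper_compact_domain.
exists (Some \o g); split=> [z|z Bz|z].
- apply: continuous_comp; first exact: cg.
  exact: one_point_compactification_some_continuous.
- have := Sf (exist (fun x => x \in B) z (mem_set Bz)).
  by rewrite -gf.
- by split=> //; exists (g z).
Qed.

End ExtensorsOnCubes.

(** * Local connectedness of absolute extensors *)

Section LocalConnectedness.
Context {R : realType} {n : nat}.
Local Notation C := (cube R n).

Let c (j : nat) : R := (2 ^ j.+1)%:R^-1.

Let c_gt0 j : 0 < c j. Proof. by rewrite invr_gt0 ltr0n expn_gt0. Qed.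

Let c_le12 j : c j <= 2^-1.
Proof. by rewrite lef_pV2 ?posrE ?ltr0n ?expn_gt0// ler_nat -[leqLHS]expn1 leq_exp2l. Qed.

Let c_le j k : (j <= k)%N -> c k <= c j.
Proof. by move=> jk; rewrite lef_pV2 ?posrE ?ltr0n ?expn_gt0// ler_nat leq_exp2l. Qed.

Let c_lt j k : (j < k)%N -> 2 * c k <= c j.
Proof.
move=> /c_le; have -> : c j.+1 = c j / 2 by rewrite /c expnS natrM invfM mulrC.
by lra.
Qed.

Let c_small (r : R) : 0 < r -> exists J, c J < r.
Proof.
move=> r0; near \oo => J; exists J.
have : J.+1%:R^-1 < r by near: J; exact: near_infty_natSinv_lt (PosNum r0).
apply: le_lt_trans; rewrite lef_pV2 ?posrE ?ltr0n ?expn_gt0// ler_nat.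
by rewrite ltnW// ltn_expl.
Unshelve. all: by end_near. Qed.

(** Were [w] an exception, there would be maps into smaller and smaller
    neighbourhoods of [w] without extensions into [V]. Placed on cubes shrinking
    to a point, where the value is [w], they extend simultaneously to a map which,
    by its continuity at that point, takes the smaller cubes into [V]. *)
Lemma relLC_at (W : topologicalType) (e : W -> nat -> R) (X : set W) (w : W) :
  (0 < n)%N -> seq_embedding e -> relAE R n X -> X w ->
  forall V, nbhs w V -> exists2 V', nbhs w V' & extends_in R n X V' V.
Proof.
move=> n0 eW aeX Xw V wV; pose l0 := Ordinal n0.
pose V' j := [set w' | seqdist (e w) (e w') < j.+1%:R^-1].
apply: contrapT => noV'.
have /choice[Bphi BphiP] : forall j, exists Bphi : set C * (C -> W),
    [/\ closed Bphi.1, {within Bphi.1, continuous Bphi.2},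
      forall z, Bphi.1 z -> X (Bphi.2 z) /\ V' j (Bphi.2 z)
    & ~ exists psi : C -> W, [/\ continuous psi, forall z, Bphi.1 z -> psi z = Bphi.2 z
      & forall z, X (psi z) /\ V (psi z)] ].
  move=> j; apply: contrapT => nB; apply: noV'; exists (V' j).
    by apply: seq_embedding_ball; rewrite ?invr_gt0.
  move=> B phi cB cphi phiX; apply: contrapT => npsi; apply: nB.
  by exists (B, phi).
pose B j := (Bphi j).1; pose phi j := (Bphi j).2.
(* [sigma j] embeds the cube as the cube of half side [c j / 4] centred at the
   point [c j] of the first axis, [tau j] retracts to it, and [P j] is a slab
   around it; as [c j] is halved at each step, the slabs are disjoint. *)
pose sigma j (v : C) : C := to_cube (fun l => (if l == l0 then c j else 0) + c j / 4 * coord v l).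
pose tau j (z : C) : C := to_cube (fun l => (coord z l - (if l == l0 then c j else 0)) * (4 / c j)).
pose P j (z : C) := `|coord z l0 - c j| < c j / 3.
have sigmaE j v l : coord (sigma j v) l = (if l == l0 then c j else 0) + c j / 4 * coord v l.
  rewrite coord_to_cube clip_id//; have := coord_le1 v l; rewrite ler_norml => /andP[v1 v2].
  have j0 := c_gt0 j; have j1 := c_le12 j.
  have : - (c j / 4) <= c j / 4 * coord v l by rewrite -mulrN1 ler_pM2l ?divr_gt0.
  have : c j / 4 * coord v l <= c j / 4 by rewrite ger_pMr ?divr_gt0.
  by case: (l == l0) => h1 h2; apply/andP; split; lra.
have sigmaK j v : tau j (sigma j v) = v.
  rewrite -[RHS]to_cubeK; congr to_cube; apply/funext => l.
  rewrite sigmaE (addrC (if _ then _ else _)) addrK mulrC mulrA.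
  by rewrite -[X in X * _]/(4 / c j * (c j / 4)) mulrA mulfVK ?gt_eqF// divff// mul1r.
have sigmaC j : continuous (sigma j).
  move=> v; apply: (@to_cube_cvg R n C (nbhs v) (nbhs_filter v)) => l.
  apply: cvgD; first exact: cvg_cst.
  by apply: cvgM; [exact: cvg_cst|exact: cube_coord_continuous].
have tauC j : continuous (tau j).
  move=> v; apply: (@to_cube_cvg R n C (nbhs v) (nbhs_filter v)) => l.
  apply: cvgM; last exact: cvg_cst.
  by apply: cvgB; [exact: cube_coord_continuous|exact: cvg_cst].
have sigma_le j v l : `|coord (sigma j v) l| <= 2 * c j.
  rewrite sigmaE; have := coord_le1 v l; rewrite ler_norml => /andP[v1 v2].
  have j0 := c_gt0 j.
  have : - (c j / 4) <= c j / 4 * coord v l by rewrite -mulrN1 ler_pM2l ?divr_gt0.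
  have : c j / 4 * coord v l <= c j / 4 by rewrite ger_pMr ?divr_gt0.
  by rewrite ler_norml; case: (l == l0) => h1 h2; apply/andP; split; lra.
have sigma_l0 j v : `|coord (sigma j v) l0 - c j| <= c j / 4.
  rewrite sigmaE eqxx (addrC (c j)) addrK normrM ger0_norm ?divr_ge0 ?(ltW (c_gt0 j))//.
  by rewrite ger_pMr ?divr_gt0//; exact: coord_le1.
have sigmaP j v : P j (sigma j v).
  by apply: le_lt_trans (sigma_l0 j v) _; have := c_gt0 j; lra.
have P_lt j k z : P j z -> P k z -> (j < k)%N -> False.
  move=> + + /c_lt; rewrite /P !ltr_norml => /andP[h1 h2] /andP[h3 h4] h5; lra.
have P_inj j k z : P j z -> P k z -> j = k.
  by move=> Pj Pk; have [/(P_lt _ _ z Pj Pk)|/(P_lt _ _ z Pk Pj)|] := ltngtP j k.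
have P_open j z : P j z -> \forall z' \near z, P j z'.
  move=> Pz.
  have cf : {for z, continuous (fun z' : C => `|coord z' l0 - c j|)}.
    have FF := @nbhs_filter C z; apply: (@cvg_norm _ _ _ (nbhs z)).
    by apply: cvgB; [exact: cube_coord_continuous|exact: cvg_cst].
  exact: (cvgr_lt _ cf _ Pz).
have /choice[f fP] : forall z, exists y, (forall j, P j z -> y = phi j (tau j z)) /\
    ((forall j, ~ P j z) -> y = w).
  move=> z; have [ [j Pj]|nP] := pselect (exists j, P j z).
    exists (phi j (tau j z)); split=> [k Pk|/(_ j)//].
    by rewrite (P_inj _ _ _ Pj Pk).
  by exists w; split=> // j Pj; case: nP; exists j.
have fsigma j v : f (sigma j v) = phi j v.
  by case: (fP (sigma j v)) => /(_ j (sigmaP j v)) -> _; rewrite sigmaK.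
pose z0 : C := to_cube (fun=> 0).
have z0E l : coord z0 l = 0 by rewrite coord_to_cube clip_id// lerN10 ler01.
have z0P j : ~ P j z0.
  by rewrite /P z0E sub0r normrN ger0_norm ?(ltW (c_gt0 j))//; have := c_gt0 j => h1 h2; lra.
have fz0 : f z0 = w by case: (fP z0) => _; apply.
pose A : set C := [set z0] `|` \bigcup_j (sigma j @` B j).
have cA : closed A.
  (* The cubes of index at least [m] lie in the box of half side [2 * c m]. *)
  have -> : A = \bigcap_m ((\bigcup_(j in [set j | (j < m)%N]) (sigma j @` B j)) `|`
      \bigcap_(l in [set: 'I_n]) [set z | `|coord z l| <= 2 * c m]).
    apply/seteqP; split=> z.
      move=> [->|[j _ [v Bv <-] ] ] m _.
        by right=> l _ /=; rewrite z0E normr0 mulr_ge0// ltW.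
      have [jm|mj] := ltnP j m; first by left; exists j => //; exists v.
      by right=> l _ /=; apply: le_trans (sigma_le _ _ _) _; rewrite ler_pM2l// c_le.
    move=> zm; have [ [m nzm]|zb] := pselect (exists m, ~ forall l, `|coord z l| <= 2 * c m).
      have [ [j _ [v Bv <-] ]|h] := zm m I; last by case: nzm => l; exact: h.
      by right; exists j => //; exists v.
    left; apply: coord_inj => l; rewrite z0E; apply/eqP; rewrite -normr_le0 leNgt.
    apply/negP => zl; have [|J Jz] := @c_small (`|coord z l| / 2); first by rewrite divr_gt0.
    apply: zb; exists J => /(_ l); lra.
  apply: closed_bigI => m _; apply: closedU.
    apply: closed_bigcup => [|j _]; first exact: finite_II.
    apply: compact_closed; first exact: (cube_hausdorff R n).
    apply: continuous_compact; first exact: continuous_subspaceT.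
    apply: subclosed_compact (cube_compact R n) _ => //.
    by case: (BphiP j).
  apply: closed_bigI => l _.
  apply: (@closed_comp _ _ (fun z : C => `|coord z l|) [set t | t <= _]); last exact: closed_le.
  by move=> z _; apply: (@cvg_norm _ _ _ (nbhs z)); exact: cube_coord_continuous.
have cf : {within A, continuous f}.
  apply/subspace_continuousP => z Az Z fZ; rewrite /= near_simpl.
  have {}fZ : nbhs (f z) Z := fZ.
  suff : \forall z' \near z, A z' -> Z (f z') by [].
  case: Az => [zz0|[j _ [v Bv vz] ] ].
    move: zz0 fZ => ->; rewrite fz0 => fZ; have [r r0 rZ] := seq_embedding_nbhs eW fZ.
    have [J Jr] : exists J : nat, J.+1%:R^-1 < r.
      near \oo => J; exists J; near: J; exact: near_infty_natSinv_lt (PosNum r0).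
    have J0 : 0 < 3 / 4 * c J by rewrite mulr_gt0.
    apply: filterS (cube_near z0 J0) => z' /(_ l0); rewrite z0E sub0r normrN => z'J.
    case=> [->|[j _ [v Bv vz'] ] ]; first by rewrite fz0; exact: nbhs_singleton.
    rewrite -vz' fsigma; have [_ _ /(_ v Bv)[_ h] _] := BphiP j.
    apply: rZ; apply: lt_trans h _; apply: le_lt_trans Jr.
    rewrite lef_pV2 ?posrE ?ltr0n// ler_nat ltnS leqNgt; apply/negP => jJ.
    have := c_le (ltnW jJ); have := sigma_l0 j v; rewrite vz' ler_norml => /andP[h1 h2] h3.
    have := ler_norm (coord z' l0); lra.
  have Pz : P j z by rewrite -vz.
  have [_ cphi _ _] := BphiP j.
  have phiZ : nbhs (phi j v) Z by rewrite -fsigma vz.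
  have /subspace_continuousP/(_ v Bv Z phiZ) h := cphi.
  have {}h : nbhs (tau j z) [set u | B j u -> Z (phi j u)] by rewrite -vz sigmaK; exact: h.
  apply: filterS2 (P_open _ _ Pz) (tauC j z _ h) => z' Pz' h' Az'.
  case: (fP z') => /(_ j Pz') -> _; apply: h'.
  case: Az' => [z'0|[k _ [u Bu uz'] ] ]; first by case: (@z0P j); rewrite -z'0.
  have kj : k = j by apply: (P_inj k j z') => //; rewrite -uz'.
  by rewrite -uz' kj sigmaK -kj.
have [|psi [cpsi psif Xpsi] ] := aeX A f cA cf.
  move=> z [->|[j _ [v Bv <-] ] ]; first by rewrite fz0.
  by rewrite fsigma; have [_ _ /(_ v Bv)[? _] _] := BphiP j.
have psi0 : psi z0 = w by rewrite psif// -?fz0//; left.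
have [r r0 rV] : exists2 r, 0 < r & forall z', (forall l, `|coord z0 l - coord z' l| < r) -> V (psi z').
  by apply: (@cube_nbhs R n z0 (psi @^-1` V)); apply: cpsi; rewrite psi0.
have [|J Jr] := @c_small (r / 2); first by rewrite divr_gt0.
have [_ _ _] := BphiP J; apply; exists (psi \o sigma J); split.
- by move=> v; apply: continuous_comp; [exact: sigmaC|exact: cpsi].
- by move=> v Bv /=; rewrite psif ?fsigma//; right; exists J => //; exists v.
- move=> v; split; first by have [] := Xpsi (sigma J v).
  apply: rV => l; rewrite z0E sub0r normrN; apply: le_lt_trans (sigma_le _ _ _) _; lra.
Unshelve. all: by end_near. Qed.

End LocalConnectedness.

Section AtInfinity.
Context {R : realType} {n : nat}.
Local Notation C := (cube R n).
Local Notation T := (nat * C)%type.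
Variable X : topologicalType.
Local Notation W := (one_point_compactification X).

(** As for [relLC_at], but now the point at infinity is not available as a value.
    Maps without extensions, into smaller and smaller neighbourhoods of infinity,
    form one proper map on a closed subset of the disjoint union [nat * C] of
    cubes; a proper extension takes all but finitely many cubes into [V]. *)
Lemma relLC_infinity (e : W -> nat -> R) :
  AEp n X -> seq_embedding e ->
  forall V, nbhs (None : W) V -> exists2 V', nbhs (None : W) V'
    & extends_in R n (range (Some : X -> W)) V' V.
Proof.
move=> aeX eW V wV; have [x0 _] := @AEp_nonempty R n X aeX; have [hX lX ae] := aeX.
have hW := one_point_compactification_hausdorff lX hX.
pose V' j := [set w' : W | seqdist (e None) (e w') < j.+1%:R^-1].
apply: contrapT => noV'.
have /choice[Bphi BphiP] : forall j, exists Bphi : set C * (C -> W),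
    [/\ closed Bphi.1, {within Bphi.1, continuous Bphi.2},
      forall z, Bphi.1 z -> range Some (Bphi.2 z) /\ V' j (Bphi.2 z)
    & ~ exists psi : C -> W, [/\ continuous psi, forall z, Bphi.1 z -> psi z = Bphi.2 z
      & forall z, range Some (psi z) /\ V (psi z)] ].
  move=> j; apply: contrapT => nB; apply: noV'; exists (V' j).
    by apply: (@seq_embedding_ball R W e eW None); rewrite invr_gt0.
  move=> B phi cB cphi phiX; apply: contrapT => npsi; apply: nB.
  by exists (B, phi).
pose A : set T := [set jz | (Bphi jz.1).1 jz.2].
have cA : closed A.
  move=> [j z] Ajz; have [cB _ _ _] := BphiP j.
  apply: cB => U zU; have [ [j' z'] [/= Az' [jj' Uz'] ] ] := Ajz _ (slice_nbhs j zU).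
  by exists z'; split=> //; rewrite -jj'.
pose f (a : set_type A) : X := odflt x0 ((Bphi (set_val a).1).2 (set_val a).2).
have Sf a : Some (f a) = (Bphi (set_val a).1).2 (set_val a).2.
  have [_ _ /(_ _ (set_valP a))[ [x _ xa] _] _] := BphiP (set_val a).1.
  by rewrite /f set_valE -xa.
have cf : continuous f.
  apply: some_continuousP => a U; rewrite Sf => fU.
  have [_ cphi _ _] := BphiP (set_val a).1.
  have /subspace_continuousP/(_ (set_val a).2 (set_valP a) U fU) h := cphi.
  have {}h : nbhs (set_val a).2 [set u | (Bphi (set_val a).1).1 u -> U ((Bphi (set_val a).1).2 u)].
    by exact: h.
  have aN : nbhs (set_val a) [set jz : T | jz.1 = (set_val a).1 /\
      ((Bphi (set_val a).1).1 jz.2 -> U ((Bphi (set_val a).1).2 jz.2))].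
    by have := slice_nbhs (set_val a).1 h; rewrite -surjective_pairing.
  have := @set_type_val_continuous T A a _ aN.
  move=> {}h; have {}h : nbhs a [set b | (set_val b).1 = (set_val a).1 /\
      ((Bphi (set_val a).1).1 (set_val b).2 -> U ((Bphi (set_val a).1).2 (set_val b).2))] by exact: h.
  suff : nbhs a [set b | U (Some (f b))] by [].
  apply: filterS h => b [ba bU]; rewrite /= Sf ba; apply: bU.
  by rewrite -ba; exact: (set_valP b).
have pf : proper_map f.
  split=> // K cK; have clK := compact_closed hX cK.
  have [r r0 rK] : exists2 r, 0 < r & forall w, seqdist (e None) (e w) < r -> ~ (Some @` K) w.
    apply: (seq_embedding_nbhs eW); exists K => // -[x|] /=.
      by move=> [ [y nKy [<-] ]|//] [x' Kx' [xx'] ]; apply: nKy; rewrite -xx'.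
    by move=> _ [].
  have [J Jr] : exists J : nat, J.+1%:R^-1 < r.
    near \oo => J; exists J; near: J; exact: near_infty_natSinv_lt (PosNum r0).
  apply: (@set_type_compact T A (\bigcup_(j in [set j | (j < J)%N]) [set jz : T | jz.1 = j])) => //.
  - by apply: closed_comp clK => a _; exact: cf.
  - rewrite bigcup_mkord; apply: bigsetU_compact => j _; exact: slice_compact.
  - move=> a Ka; exists (set_val a).1 => //=; rewrite ltnNge; apply/negP => Ja.
    have [_ _ /(_ _ (set_valP a))[_ h] _] := BphiP (set_val a).1.
    apply: (rK (Some (f a))); last by exists (f a).
    rewrite Sf; apply: lt_trans h _; apply: le_lt_trans Jr.
    by rewrite lef_pV2 ?posrE ?ltr0n// ler_nat ltnS.
have [g [cg pg] gf] := ae T nat_cube_hausdorff nat_cube_locally_compact nat_cube_lindelof nat_cube_dim A f cA pf.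
have [K [cK clK] KV] := wV.
have [jz _|s _ scov] := compact_finite_cover (P := fun jz => [set jz' : T | jz'.1 = jz.1]) (pg K cK).
  apply: filterS (slice_nbhs jz.1 (@filterT _ _ (nbhs_filter jz.2))) => //.
  by move=> jz' [].
have [j jP] : exists j, forall jz, jz \in s -> (jz.1 < j)%N.
  exists (\max_(jz <- s) jz.1).+1 => jz jzs; rewrite ltnS.
  by rewrite (big_rem jz)//= leq_maxl.
have [_ _ _] := BphiP j; apply; exists (fun z => Some (g (j, z))); split.
- move=> z; apply: (@continuous_comp _ _ _ (fun z => g (j, z)) (Some : X -> W)).
    by apply: (@continuous_comp _ _ _ (fun z => (j, z) : T) g); [exact: slice_continuous|exact: cg].
  exact: one_point_compactification_some_continuous.
- move=> z Bz; have Ajz : A (j, z) by [].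
  have := Sf (exist (fun x => x \in A) (j, z) (mem_set Ajz)).
  by rewrite -gf.
- move=> z; split; first by exists (g (j, z)).
  apply: KV; left; exists (g (j, z)) => // Kg.
  by have [jz /jP + /= jE] := scov (j, z) Kg; rewrite -jE ltnn.
Unshelve. all: by end_near. Qed.

End AtInfinity.

(** * Z-sets and uniform approximation *)

Section CompactOpen.
Context {R : realType} {n : nat} (W : topologicalType) (e : W -> nat -> R) (A : set W).
Local Notation C := (cube R n).
Import ArrowAsCompactOpen.

Lemma open_big_setI (T : topologicalType) (I : eqType) (s : seq I) (G : I -> set T) :
  (forall i, i \in s -> open (G i)) -> open [set x | forall i, i \in s -> G i x].
Proof.
elim: s => [|i s IH] sG.
  by rewrite (_ : mkset _ = setT); [exact: openT|apply/seteqP; split].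
have -> : [set x | forall j, j \in i :: s -> G j x] = G i `&` [set x | forall j, j \in s -> G j x].
  apply/seteqP; split=> x.
    by move=> xG; split=> [|j js]; apply: xG; rewrite inE ?eqxx ?js ?orbT.
  by move=> [xi xs] j; rewrite inE => /orP[/eqP->|/xs].
apply: openI; first by apply: sG; rewrite mem_head.
by apply: IH => j js; apply: sG; rewrite inE js orbT.
Qed.

Hypothesis eW : seq_embedding e.

(** Finitely many compact sets on which [h] varies little cover the cube; the maps
    sending each of them into a small ball form an open set. *)
Lemma Zset_approx : Zset R n A -> forall (h : C -> W) (r : R), continuous h -> 0 < r ->
  exists h' : C -> W, [/\ continuous h', forall z, ~ A (h' z)
    & forall z, seqdist (e (h z)) (e (h' z)) <= r].
Proof.
move=> [_ dA] h r ch r0; have [_ ce _ _] := eW.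
have r40 : 0 < r / 4 by rewrite divr_gt0.
pose K z := [set z' | seqdist (e (h z)) (e (h z')) <= r / 4].
pose N z := [set w | seqdist (e (h z)) (e w) < r / 2].
have cK z : compact (K z).
  apply: subclosed_compact (cube_compact R n) _ => //.
  apply: (@closed_comp _ _ (fun z' => seqdist (e (h z)) (e (h z'))) [set t | t <= _]); last exact: closed_le.
  move=> z' _; apply: (@continuous_seqdist R C (fun=> e (h z)) (fun z' => e (h z'))) => i.
    exact: cst_continuous.
  by move=> t; apply: (@continuous_comp _ _ _ h (e^~ i)); [exact: ch|exact: ce].
have oN z : open (N z).
  apply: (@open_comp _ _ (fun w => seqdist (e (h z)) (e w)) [set t | t < _]); last exact: open_lt.
  move=> w _; apply: (@continuous_seqdist R W (fun=> e (h z)) e) => // i t.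
  exact: cvg_cst.
have [z _|s _ scov] := compact_finite_cover (P := K) (cube_compact R n).
  have := ch z _ (seq_embedding_ball eW (h z) r40) => hz.
  have {}hz : nbhs z [set z' | seqdist (e (h z)) (e (h z')) < r / 4] by exact: hz.
  by apply: filterS hz => z' /ltW.
pose G : set {compact-open, C -> W} := [set g | forall z, z \in s -> g @` K z `<=` N z].
have oG : open G.
  apply: (@open_big_setI {compact-open, C -> W} C s (fun z => [set g | g @` K z `<=` N z])) => z _.
  exact: compact_open_open.
pose G' : set (continuousType C W) := [set g | G (g : C -> W)].
have [||g [Gg Ag]] := dA G'.
- exists (mkcts ch : continuousType C W) => z _ w [z' zz' <-]; apply: le_lt_trans zz' _.
  by rewrite ltr_pM2l// ltf_pV2 ?posrE// ltr_nat.
- by exists G.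
exists g; split=> [|z|z]; first exact: cts_fun.
  by apply: Ag; exists z.
have [//|a a_s az] := scov z.
have ag : seqdist (e (h a)) (e (g z)) < r / 2 by apply: (Gg a a_s); exists z.
have := seqdist_triangle (e (h a)) (e (h z)) (e (g z)); rewrite (seqdistC (e (h z)) (e (h a))).
have : seqdist (e (h a)) (e (h z)) <= r / 4 := az.
lra.
Qed.

(** Better and better approximations converge in the compact-open topology. *)
Lemma Zset_of_approx : closed A ->
  (forall (h : C -> W) (r : R), continuous h -> 0 < r ->
    exists h' : C -> W, [/\ continuous h', forall z, ~ A (h' z)
      & forall z, seqdist (e (h z)) (e (h' z)) <= r]) -> Zset R n A.
Proof.
move=> cA app; split=> // Q [f Qf] [G oG GO].
have /choice[h hP] : forall m : nat, exists h' : C -> W, [/\ continuous h',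
    forall z, ~ A (h' z) & forall z, seqdist (e (f z)) (e (h' z)) <= m.+1%:R^-1].
  by move=> m; apply: app; [exact: cts_fun|rewrite invr_gt0].
have hf : (h m : {compact-open, C -> W}) @[m --> \oo] --> (f : {compact-open, C -> W}).
  apply/compact_open_cvgP => K N cK oN fKN.
  have /choice[r rP] : forall z, exists r, 0 < r /\
      (K z -> forall w, seqdist (e (f z)) (e w) < r -> N w).
    move=> z; have [Kz|nKz] := pselect (K z); last by exists 1.
    have [|r r0 rN] := @seq_embedding_nbhs R W e eW (f z) N.
      by apply: open_nbhs_nbhs; split=> //; apply: fKN; exists z.
    by exists r.
  have [z _|s sK scov] := compact_finite_cover
      (P := fun z => [set z' | seqdist (e (f z)) (e (f z')) < r z / 2]) cK.
    have rz : 0 < r z / 2 by rewrite divr_gt0//; case: (rP z).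
    have fz : nbhs z [set z' | seqdist (e (f z)) (e (f z')) < r z / 2].
      exact: (@cts_fun _ _ f z _ (seq_embedding_ball eW (f z) rz)).
    exact: fz.
  have [|d d0 ds] := @seq_positive_min R C s (fun z => r z / 2).
    by move=> z _; rewrite divr_gt0//; case: (rP z).
  suff : \forall m \near \oo, h m @` K `<=` N by [].
  near=> m => _ [z Kz <-]; have [a a_s az] := scov z Kz.
  have [_ /(_ (sK _ a_s))] := rP a; apply.
  have md : m.+1%:R^-1 < d by near: m; exact: near_infty_natSinv_lt (PosNum d0).
  have [_ _ /(_ z) hz] := hP m.
  apply: le_lt_trans (seqdist_triangle (e (f z)) _ _) _.
  rewrite [ltRHS](splitr (r a)) ltrD//.
  by rewrite (le_lt_trans hz)// (lt_le_trans md)// ds.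
have Gf : G f by rewrite -GO in Qf.
have [m Gm] : exists m, G (h m).
  have [m _ /(_ m (leqnn _))] := hf G (open_nbhs_nbhs (conj oG Gf)).
  by exists m.
have [chm Ahm _] := hP m.
exists (mkcts chm : continuousType C W); split; first by rewrite -GO.
by move=> _ [z _ <-]; exact: Ahm.
Unshelve. all: by end_near. Qed.

End CompactOpen.


(** * Complements of Z-sets *)

Section PushOff.
Context {R : realType} {n : nat} (K : topologicalType) (e : K -> nat -> R) (A : set K).
Local Notation C := (cube R n).

Lemma seqdist_mono (a b c d : nat -> R) :
  (forall i, `|a i - b i| <= `|c i - d i|) -> seqdist a b <= seqdist c d.
Proof.
move=> abcd; apply/seqdist_le => i; apply: le_trans (seqdist_coord c d i).
by rewrite le_min !ge_min abcd lexx orbT.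
Qed.

Lemma setdist_gt0 k : seq_embedding e -> closed A -> A !=set0 -> ~ A k ->
  0 < setdist (e @` A) (e k).
Proof.
move=> eW cA [a0 Aa0] nAk.
have [|r r0 rA] := @seq_embedding_nbhs R K e eW k (~` A).
  by apply: open_nbhs_nbhs; split=> //; exact: closed_openC.
apply: lt_le_trans r0 _; apply: lb_le_inf.
  by exists (seqdist (e k) (e a0)), (e a0) => //; exists a0.
by move=> _ [_ [a Aa <-] <-]; rewrite leNgt; apply/negP => /rA; exact.
Qed.

Hypothesis eW : seq_embedding e.
Hypotheses (aeK : relAE R n [set: K]) (lcK : relLC R n [set: K]).
Hypotheses (cA : closed A) (A0 : A !=set0).
Hypothesis approxA : forall (h : C -> K) (r : R), continuous h -> 0 < r ->
  exists h' : C -> K, [/\ continuous h', forall z, ~ A (h' z)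
    & forall z, seqdist (e (h z)) (e (h' z)) <= r].

(** Interpolate, in the ambient space of sequences, between the given map near
    [B] and an approximation avoiding [A] elsewhere, and correct the result by
    the controlled extension theorem. Where the interpolation is not constant,
    the given map is far from [A] compared with the correction. *)
Lemma push_off (B : set C) (phi : C -> K) (r : R) :
  closed B -> continuous phi -> (forall z, B z -> ~ A (phi z)) -> 0 < r ->
  exists g : C -> K, [/\ continuous g, forall z, B z -> g z = phi z,
    forall z, ~ A (g z) & forall z, seqdist (e (phi z)) (e (g z)) <= r].
Proof.
move=> cB cphi phiB r0; have [_ ce _ ie] := eW; have [a0 Aa0] := A0.
have eA0 : e @` A !=set0 by exists (e a0), a0.
have eK0 : range e !=set0 by exists (e a0), a0.
have [theta mtheta thetaP] := controlled_extension a0 eW aeK lcK.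
have cephi i : continuous (fun z => e (phi z) i).
  by move=> z; apply: (@continuous_comp _ _ _ phi (e^~ i)); [exact: cphi|exact: ce].
pose d z := setdist (e @` A) (e (phi z)).
have cd : continuous d by apply: continuous_setdist.
have [tau tau0 dtau] : exists2 tau, 0 < tau & forall z, B z -> tau <= d z.
  apply: compact_positive_min => // [|z Bz].
    by apply: subclosed_compact cB (cube_compact R n) _.
  by apply: setdist_gt0 => //; exact: phiB.
pose eta := Num.min r tau / 8.
have eta0 : 0 < eta by rewrite divr_gt0// lt_min r0.
have [_ _ /(_ _ eta0)[del del0 delP] ] := mtheta.
pose eps := Num.min eta (del / 4).
have eps0 : 0 < eps by rewrite lt_min eta0 divr_gt0.
have eps_eta : eps <= eta by rewrite ge_min lexx.
have eps_del : 2 * eps < del.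
  have : eps <= del / 4 by rewrite ge_min lexx orbT.
  by lra.
have [h [ch hA hphi] ] := approxA cphi eps0.
have ceh i : continuous (fun z => e (h z) i).
  by move=> z; apply: (@continuous_comp _ _ _ h (e^~ i)); [exact: ch|exact: ce].
(* [lam] is [0] on [B] and [1] where [d z <= tau / 2]. *)
pose lam (z : C) : R := Num.min 1 (Num.max 0 ((tau - d z) * (2 / tau))).
have clam : continuous lam.
  move=> z; apply: (@continuous_min R C (fun=> 1) (fun z => Num.max 0 ((tau - d z) * (2 / tau)))).
    exact: cst_continuous.
  apply: (@continuous_max R C (fun=> 0) (fun z => (tau - d z) * (2 / tau))).
    exact: cst_continuous.
  have FF := @nbhs_filter C z.
  by apply: cvgM; [apply: cvgB; [exact: cvg_cst|exact: cd]|exact: cvg_cst].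
have lam01 z : 0 <= lam z <= 1.
  by rewrite /lam le_min ler01 le_max lexx ge_min lexx.
pose F (z : C) i := (1 - lam z) * e (phi z) i + lam z * e (h z) i.
(* [s] vanishes where [F] is one of the two given maps, so [g] keeps them there. *)
pose s (z : C) := eps * (lam z * (1 - lam z)).
have cF i : continuous (F^~ i).
  move=> z; have FF := @nbhs_filter C z.
  apply: cvgD; apply: cvgM; [|exact: cephi|exact: clam|exact: ceh].
  by apply: cvgB; [exact: cvg_cst|exact: clam].
have cs : continuous s.
  move=> z; have FF := @nbhs_filter C z.
  apply: cvgM; first exact: cvg_cst.
  by apply: cvgM; [exact: clam|apply: cvgB; [exact: cvg_cst|exact: clam] ].
have s0 z : 0 <= s z.
  by have /andP[l0 l1] := lam01 z; rewrite mulr_ge0 ?(ltW eps0)// mulr_ge0// subr_ge0.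
have s_eps z : s z <= eps.
  have /andP[l0 l1] := lam01 z; rewrite /s ger_pMr//.
  by rewrite mulr_ile1// ?subr_ge0// gerBl.
have Fphi z : seqdist (F z) (e (phi z)) <= eps.
  apply: le_trans (hphi z); rewrite [leRHS]seqdistC; apply: seqdist_mono => i.
  have -> : F z i - e (phi z) i = lam z * (e (h z) i - e (phi z) i) by rewrite /F; ring.
  have /andP[l0 l1] := lam01 z; rewrite normrM (ger0_norm l0).
  by rewrite ler_piMl.
have dKF z : setdist (range e) (F z) <= eps.
  by apply: le_trans (Fphi z); apply: setdist_le; exists (phi z).
have [|||g [cg gF _ gclose] ] := thetaP C (@cube_hausdorff R n) _ cube_dim F s cF cs s0.
- by apply: compact_locally_compact; exact (cube_compact R n).
- move=> t _; apply: subclosed_compact (cube_compact R n) _ => //.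
  by apply: (@closed_comp _ _ s [set x | t <= x]) => [z _|]; [exact: cs|exact: closed_ge].
- move=> z /eqP; rewrite mulf_eq0 gt_eqF//= mulf_eq0 => /orP[/eqP l0|].
    by exists (phi z); apply/funext => i; rewrite /F l0 subr0 mul1r mul0r addr0.
  rewrite subr_eq0 => /eqP l1.
  by exists (h z); apply/funext => i; rewrite /F -l1 subrr mul0r mul1r add0r.
have gphi z : seqdist (e (phi z)) (e (g z)) <= 2 * eta.
  have [sz|sz] := ltP 0 (s z); last first.
    rewrite gF; last by apply/eqP; rewrite eq_le sz s0.
    by rewrite seqdistC; have := Fphi z; lra.
  have gz : seqdist (e (g z)) (F z) <= eta.
    apply: le_trans (gclose z sz) _; apply: delP; first exact: ltr_wpDr (setdist_ge0 _ _) sz.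
    by have := s_eps z; have := dKF z; lra.
  have := seqdist_triangle (F z) (e (phi z)) (e (g z)).
  rewrite (seqdistC (e (phi z)) (F z)) (seqdistC (F z) (e (g z))).
  by have := Fphi z; lra.
have eta_tau : 8 * eta <= tau by rewrite /eta mulrC divfK// ge_min lexx orbT.
have eta_r : 8 * eta <= r by rewrite /eta mulrC divfK// ge_min lexx.
exists g; split=> // [z Bz|z Agz|z]; last by have := gphi z; lra.
- have l0 : lam z = 0.
    rewrite /lam (max_idPl _) ?(min_idPr _)//.
    by rewrite mulr_le0_ge0 ?divr_ge0 ?(ltW tau0)// subr_le0; exact: dtau.
  apply: ie; rewrite gF; last by rewrite /s l0 mul0r mulr0.
  by apply/funext => i; rewrite /F l0 subr0 mul1r mul0r addr0.
- have dz : d z <= 2 * eta.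
    by apply: le_trans (gphi z); apply: setdist_le; exists (g z).
  have l1 : lam z = 1.
    rewrite /lam; apply/min_idPl; rewrite le_max; apply/orP; right.
    by rewrite mulrA ler_pdivlMr// mul1r; lra.
  apply: (hA z); suff <- : g z = h z by [].
  apply: ie; rewrite gF; last by rewrite /s l1 subrr !mulr0.
  by apply/funext => i; rewrite /F l1 subrr mul0r mul1r add0r.
Qed.

Lemma relAE_setC : relAE R n (~` A).
Proof.
move=> B phi cB cphi phiA.
have [z Bz|psi [cpsi psiB _] ] := aeK cB cphi; first by split.
have [z Bz|g [cg gB gA _] ] := push_off cB cpsi _ ltr01.
  by rewrite psiB//; case: (phiA z Bz).
by exists g; split=> // [z Bz|z]; [rewrite gB// psiB|split=> //; exact: gA].
Qed.

Lemma relLC_setC : relLC R n (~` A).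
Proof.
move=> w V /(seq_embedding_nbhs eW)[r r0 rV].
have r20 : 0 < r / 2 by rewrite divr_gt0.
have [V' wV' ext] := lcK (seq_embedding_ball eW w r20).
exists V' => // B phi cB cphi phiA.
have [z Bz|psi [cpsi psiB psir] ] := ext B phi cB cphi; first by case: (phiA z Bz).
have r40 : 0 < r / 4 by rewrite divr_gt0.
have [z Bz|g [cg gB gA gpsi] ] := push_off cB cpsi _ r40.
  by rewrite psiB//; case: (phiA z Bz).
exists g; split=> // [z Bz|z]; first by rewrite gB// psiB.
split; first exact: gA.
apply: rV; have [_ wpsi] := psir z.
have : seqdist (e w) (e (psi z)) < r / 2 := wpsi.
by have := seqdist_triangle (e (psi z)) (e w) (e (g z)); have := gpsi z; lra.
Qed.

End PushOff.

(** * Embeddings of compactifications *)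

Section Embeddings.
Context {R : realType}.

Lemma separable_sequence (T : topologicalType) (t0 : T) : separable T ->
  exists d : nat -> T, forall V : set T, open V -> V !=set0 -> exists m, V (d m).
Proof.
move=> [D cD dD]; have /countable_injP[c cinj] := cD.
have /choice[d dP] : forall m, exists t, forall t', D t' -> c t' = m -> t = t'.
  move=> m; have [ [t [Dt ct] ]|nD] := pselect (exists t, D t /\ c t = m).
    by exists t => t' Dt' ct'; apply: cinj; rewrite ?inE// ct ct'.
  by exists t0 => t' Dt' ct'; case: nD; exists t'.
exists d => V oV V0; have [t [Vt Dt] ] := dD V V0 oV.
by exists (c t); rewrite (dP _ t).
Qed.

(** Truncated distances to the points of a dense sequence separate points. *)
Lemma metrizable_embedding (K : topologicalType) (d : nat -> K) :
  compact [set: K] -> metrizable R K ->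
  (forall V : set K, open V -> V !=set0 -> exists m, V (d m)) ->
  exists e : K -> nat -> R, seq_embedding e.
Proof.
move=> cK [rho [rho0 rho_eq0 rhoC rhoD rho_nbhs] ] dK.
have rho_ball x r : 0 < r -> nbhs x [set y | rho x y < r].
  by move=> r0; rewrite rho_nbhs; exists r.
exists (fun k i => Num.min 1 (rho (d i) k)); split=> //.
- move=> i; suff c : continuous (rho (d i)).
    by move=> k; apply: (@continuous_min R K (fun=> 1) (rho (d i))); [exact: cst_continuous|exact: c].
  move=> k; apply/cvgrPdist_le => /= r r0; apply: filterS (rho_ball k r r0) => k' kk'.
  have h1 := rhoD (d i) k k'; have h2 := rhoD (d i) k' k; have h3 := rhoC k k'.
  have {}kk' : rho k k' < r := kk'.
  by rewrite ler_norml; apply/andP; split; lra.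
- by move=> k i; rewrite ger0_norm ?ge_min ?lexx// le_min ler01 rho0.
- move=> k k' kk'; apply/rho_eq0/eqP; rewrite eq_le rho0 andbT leNgt; apply/negP => kk'0.
  pose r := Num.min 1 (rho k k') / 3.
  have r0 : 0 < r by rewrite divr_gt0// lt_min ltr01.
  have r1 : 3 * r <= 1 by rewrite /r mulrC divfK// ge_min lexx.
  have rk : 3 * r <= rho k k' by rewrite /r mulrC divfK// ge_min lexx orbT.
  have [||m /interior_subset/= mk] := dK [set y | rho k y < r]°.
  + exact: open_interior.
  + by exists k; exact: rho_ball.
  have := congr1 (fun f => f m) kk'; rewrite /= (min_idPr _); last first.
    by rewrite rhoC; lra.
  have h1 := rhoD k (d m) k'; rewrite (rhoC (d m) k).
  by rewrite /Num.min; case: ifP => _; lra.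
Qed.

Lemma subset_embedding (K : topologicalType) (e : K -> nat -> R) (M : set K) :
  closed M -> seq_embedding e -> seq_embedding (fun m : set_type M => e (set_val m)).
Proof.
move=> cM [cK ce e1 ie]; split=> //.
- apply: (@set_type_compact _ M setT) => //; exact: closedT.
- move=> i m; apply: (@continuous_comp _ _ _ (set_val : set_type M -> K) (e^~ i)).
    exact: set_type_val_continuous.
  exact: ce.
- by move=> m m' /ie/val_inj.
Qed.

(** The functions are the positive parts of [m.+1%:R^-1 - mdist (d a)], for those
    [a] and [m] for which the ball that contains the support is compact: they
    extend by [0] to the point at infinity. *)
Lemma one_point_compactification_embedding (X : metricType R) (x0 : X) :
  locally_compact [set: X] -> separable X ->
  exists e : one_point_compactification X -> nat -> R, seq_embedding e.
Proof.
move=> lX sX; have [d dP] := separable_sequence x0 sX.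
pose cb (a m : nat) := [set y | mdist (d a) y <= m.+1%:R^-1].
have cmd (a : X) : continuous (mdist a).
  move=> y; apply/cvgrPdist_le => /= r r0.
  apply: filterS (nbhsx_ballx y r r0) => y'; rewrite ballEmdist/= => yy'.
  have h1 := metric_triangle a y y'; have h2 := metric_triangle a y' y.
  have h3 := metric_sym y y'.
  by rewrite ler_norml; apply/andP; split; lra.
have clcb a m : closed (cb a m).
  by apply: (@closed_comp _ _ (mdist (d a)) [set t | t <= _]) => [y _|]; [exact: cmd|exact: closed_le].
pose bump (am : nat * nat) (y : X) : R :=
  if `[< compact (cb am.1 am.2) >] then Num.max 0 (am.2.+1%:R^-1 - mdist (d am.1) y) else 0.
pose e (w : one_point_compactification X) (i : nat) : R :=
  if choice.unpickle i is Some am then (if w is Some y then bump am y else 0) else 0.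
have cbump am : continuous (bump am).
  rewrite /bump; case: `[< _ >]; last exact: cst_continuous.
  move=> y; apply: (@continuous_max R X (fun=> 0) (fun y => am.2.+1%:R^-1 - mdist (d am.1) y)).
    exact: cst_continuous.
  by apply: cvgB; [exact: cvg_cst|exact: cmd].
exists e; split.
- exact: one_point_compactification_compact.
- move=> i; rewrite /e; case: (choice.unpickle i) => {i}[am|]; last exact: cst_continuous.
  case=> [y V fV|V fV].
    by have h := cbump am y V fV; exact: h.
  have [cam|ncam] := pselect (compact (cb am.1 am.2)); last first.
    have V0 : V 0 := nbhs_singleton fV.
    pose f (w : one_point_compactification X) : R := if w is Some y then bump am y else 0.
    have fT : f @^-1` V = setT.
      by rewrite -subTset => -[y|]//= _; rewrite /bump asboolF.
    change (nbhs (None : one_point_compactification X) (f @^-1` V)).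
    rewrite fT; exact: (@filterT _ (nbhs (None : one_point_compactification X))).
  exists (cb am.1 am.2); first by split=> //; exact: clcb.
  move=> _ [ [y ncb <-]|->] /=; last exact: nbhs_singleton fV.
  rewrite /bump asboolT// (max_idPl _); first exact: nbhs_singleton fV.
  by rewrite subr_le0 ltW// ltNge; exact/negP.
- move=> w i; rewrite /e; case: (choice.unpickle i) => [am|]; last by rewrite normr0.
  case: w => [y|]; last by rewrite normr0.
  rewrite /bump; case: ifP => _; last by rewrite normr0.
  rewrite ger0_norm ?le_max ?lexx// ge_max ler01/=.
  rewrite (@le_trans _ _ am.2.+1%:R^-1)// ?invf_le1 ?ltr0n ?ler1n//.
  by rewrite gerBl mdist_ge0.
- suff sep y w : Some y <> w -> exists i, e (Some y) i != e w i.
    move=> w w' ww'; apply: contrapT; case: w ww' => [y|] ww' nww'.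
      by have [i] := sep _ _ nww'; rewrite ww' eqxx.
    case: w' ww' nww' => [y'|//] ww' nww'.
    by have [i|i] := sep y' None; [|rewrite ww' eqxx].
  move=> yw; have [U] := @lX y I; rewrite withinET => /nbhs_ballP[r /= r0 rU] [cU clU].
  have [m [mr mw] ] : exists m : nat, 2 * m.+1%:R^-1 < r /\
      if w is Some y' then 2 * m.+1%:R^-1 < mdist y y' else True.
    pose r' := if w is Some y' then Num.min r (mdist y y') else r.
    have r'0 : 0 < r' / 2.
      rewrite divr_gt0// /r'; case: w yw {r'} => [y' yw|//].
      by rewrite lt_min r0 mdist_gt0; apply/eqP => yy'; apply: yw; rewrite yy'.
    have [m mr'] : exists m : nat, m.+1%:R^-1 < r' / 2.
      near \oo => m; exists m; near: m; exact: near_infty_natSinv_lt (PosNum r'0).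
    exists m; move: mr'; rewrite ltr_pdivlMr// mulrC /r'.
    by case: w {yw r' r'0} => [y'|//]; rewrite lt_min => /andP[].
  have [k kE] : exists k : R, k = m.+1%:R^-1 by exists (m.+1%:R^-1).
  rewrite -kE in mr mw.
  have k0 : 0 < k by rewrite kE.
  have [||a /interior_subset] := dP (ball y (k / 2))°.
  + exact: open_interior.
  + by exists y; apply: nbhsx_ballx; rewrite divr_gt0.
  rewrite ballEmdist/= => ya.
  have ca : compact (cb a m).
    apply: subclosed_compact cU _ => // z /= za; apply: rU; rewrite ballEmdist/=.
    apply: le_lt_trans (metric_triangle y (d a) z) _.
    have {}za : mdist (d a) z <= k by rewrite kE.
    lra.
  exists (choice.pickle (a, m)); rewrite /e choice.pickleK /bump asboolT//= (metric_sym (d a)) -kE.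
  have ey : 0 < k - mdist y (d a) by lra.
  rewrite (max_idPr (ltW ey)).
  case: w yw mw => [y'|] yw mw; last by rewrite gt_eqF.
  rewrite (max_idPl _) ?gt_eqF//.
  by have := metric_triangle y (d a) y'; lra.
Unshelve. all: by end_near. Qed.

End Embeddings.

(** * Extensors with an extensor remainder *)

Section Compactifications.
Context {R : realType}.

Section Embedding.
Variables (X K : topologicalType) (i : X -> K).
Hypothesis oX : @open X = [set i @^-1` V | V in @open K].

Lemma embedding_continuous : continuous i.
Proof. by apply/continuousP => V oV; rewrite oX; exists V. Qed.

Lemma embedding_continuousP (T : topologicalType) (g : T -> X) :
  continuous (i \o g) -> continuous g.
Proof.
move/continuousP => ig; apply/continuousP => U; rewrite oX => -[V oV <-].
exact: ig V oV.
Qed.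

(** A cluster point of the image of a filter lies in the range by assumption, and
    its preimage is a cluster point of the filter. *)
Lemma embedding_preimage_compact (L : set K) :
  compact L -> L `<=` range i -> compact (i @^-1` L).
Proof.
move=> cL Li F PF FL.
have [k [Lk kF] ] := cL (i @ F) (fmap_proper_filter _ PF) FL.
have [x _ xk] := Li k Lk; rewrite -{}xk in Lk kF.
exists x; split=> // P B FP; rewrite nbhsE => -[U [oU Ux] UB].
move: oU; rewrite oX => -[V oV VU].
have FP' : F (i @^-1` (i @` P)) by apply: filterS FP => y Py; exists y.
have [|_ [ [y Py <-] Vy] ] := kF _ V FP'.
  by apply: open_nbhs_nbhs; split=> //; move: Ux; rewrite -VU.
by exists y; split=> //; apply: UB; rewrite -VU.
Qed.

End Embedding.

(** Tietze's theorem on the one-point compactification, on the closed set made of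
    [A] and the point at infinity, where the value is [0]. *)
Lemma extend_vanishing (Y : topologicalType) (A : set Y) (D : Y -> nat -> R) (c : R) :
  hausdorff_space Y -> locally_compact [set: Y] -> closed A ->
  (forall j, continuous (D^~ j)) -> (forall y j, `|D y j| <= c) ->
  (forall r, 0 < r -> exists2 Q, compact Q &
     forall y, A y -> ~ Q y -> seqdist (fun=> 0) (D y) <= r) ->
  exists q : Y -> nat -> R, [/\ forall j, continuous (q^~ j),
    forall y, A y -> q y = D y
  & forall r, 0 < r -> compact [set y | r <= seqdist (fun=> 0) (q y)] ].
Proof.
move=> hY lY cA cD Dc Dinf.
pose opc := one_point_compactification Y.
pose phi (t : opc) : nat -> R := if t is Some y then D y else fun=> 0.
pose A' : set opc := ~` (Some @` (~` A)).
have cA' : closed A'.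
  apply: open_closedC; apply: one_point_compactification_open_some.
  exact: closed_openC.
have A'A y : A' (Some y) -> A y.
  by move=> A'y; apply: contrapT => nAy; apply: A'y; exists y.
have AA' y : A y -> A' (Some y) by move=> Ay [y' nAy' [yy'] ]; apply: nAy'; rewrite yy'.
have A'N : A' None by case.
have cphi j : {within A', continuous (fun t => phi t j)}.
  apply/subspace_continuousP => -[y|] A't.
    apply: cvg_within_filter => V DV; exact: (cD j y V DV).
  apply: seqdist_cvgP => r r0; have [Q cQ QD] := Dinf r r0.
  exists Q; first by split=> //; exact: compact_closed hY cQ.
  move=> _ [ [y nQy <-]|->] /= A't'; last by rewrite seqdistxx ltW.
  by apply: QD => //; exact: A'A.
have c0 : 0 < Num.max 1 c by rewrite lt_max ltr01.
have /choice[p pP] : forall j, exists p : opc -> R,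
    [/\ {in A', (fun t => phi t j) =1 p}, continuous p & forall t, `|p t| <= Num.max 1 c].
  move=> j; apply: (continuous_bounded_extension _ cA' c0 (cphi j)).
    exact: one_point_compactification_normal hY lY.
  by case=> [y|] _; rewrite /phi ?normr0 ?(ltW c0)// le_max Dc orbT.
exists (fun y j => p j (Some y)); split.
- move=> j y; have [_ cp _] := pP j.
  apply: (@continuous_comp _ _ _ (Some : Y -> opc) (p j)); last exact: cp.
  exact: one_point_compactification_some_continuous.
- by move=> y Ay; apply/funext => j; have [<-//] := pP j; rewrite inE; exact: AA'.
- move=> r r0; apply: (compact_superlevel (u := fun t => seqdist (fun=> 0) (p^~ t))).
    by apply: continuous_seqdist => j; [exact: cst_continuous|case: (pP j)].
  have <- : (fun=> 0) = p^~ None by apply/funext => j; have [<-//] := pP j; rewrite inE.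
  by rewrite seqdistxx.
Qed.

Lemma embedding_extension (Y K : topologicalType) (e : K -> nat -> R) (A : set Y)
    (f : Y -> K) :
  normal_space Y -> seq_embedding e -> closed A -> {within A, continuous f} ->
  exists F : Y -> nat -> R, [/\ forall j, continuous (F^~ j),
    forall y, A y -> F y = e (f y) & forall y j, `|F y j| <= 1].
Proof.
move=> nY [_ ce e1 _] cA cf.
have /choice[F FP] : forall j, exists F : Y -> R,
    [/\ {in A, (fun y => e (f y) j) =1 F}, continuous F & forall y, `|F y| <= 1].
  move=> j; apply: (continuous_bounded_extension nY cA ltr01 (f := fun y => e (f y) j)) => // y.
  by apply: (@continuous_comp _ _ _ (f : subspace A -> K) (e^~ j)); [exact: cf|exact: ce].
exists (fun y j => F j y); split=> [j|y Ay|y j]; try by case: (FP j).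
by apply/funext => j; have [<-//] := FP j; rewrite inE.
Qed.

(** Let [M] be the remainder. First send [Y] to [M] by a map [g1] that approaches
    the given map on [A] at infinity, then correct [g1] by a map vanishing at
    infinity into a map [F1] with the right values on [A] in the ambient space of
    sequences, and finally push [F1] into [X] by a displacement that vanishes at
    infinity. The result approaches [g1], hence [M], at infinity: it is proper as
    a map to [X]. The last step uses that [X], as the complement of a Z-set of
    [K], is a relative absolute extensor in [K]. *)
Lemma compactification_AEp (n : nat) (X K : topologicalType) (i : X -> K) : (0 < n)%N ->
  hausdorff_space X -> locally_compact [set: X] -> separable X ->
  compactification i -> metrizable R K -> AE R n K ->
  AE R n (set_type (~` range i)) -> Zset R n (~` range i) -> AEp n X.
Proof.
move=> n0 hX lX sX [ [cK hK] [ii oX] di] mK aeK aeM zM.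
pose M := ~` range i; have cM : closed M by case: zM.
have [k0 _] := AE_nonempty aeK; have [m0 _] := AE_nonempty aeM.
have ci := embedding_continuous oX.
have [x0 _] : exists x : X, True.
  by have [|_ [_ [x _ _] ] ] := di [set: K] _ openT; [exists k0|exists x].
have [d dP] := separable_sequence x0 sX.
have [e eK] : exists e : K -> nat -> R, seq_embedding e.
  apply: (metrizable_embedding (d := i \o d)) => // V oV V0.
  have [k [Vk [x _ xk] ] ] := di V V0 oV; rewrite -xk in Vk.
  have [||m Vm] := dP (i @^-1` V); [|by exists x|by exists m].
  by rewrite oX; exists V.
have [_ ce e1 ie] := eK.
pose eM (m : set_type M) := e (set_val m).
have eM' : seq_embedding eM by exact: subset_embedding.
have aeK' := AE_relAE aeK; have aeM' := AE_relAE aeM.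
have lcK : relLC R n [set: K] by move=> w; exact: relLC_at.
have lcM : relLC R n [set: set_type M] by move=> w; exact: (relLC_at n0 eM').
have M0 : M !=set0 by exists (set_val m0); exact: set_valP.
have aeX : relAE R n (~` M) by apply: (relAE_setC eK) => // h r; exact: Zset_approx eK zM h r.
have lcX : relLC R n (~` M) by apply: (relLC_setC eK) => // h r; exact: Zset_approx eK zM h r.
have [theta1 mtheta1 theta1P] := controlled_extension m0 eM' aeM' lcM.
have [theta2 mtheta2 theta2P] := controlled_extension k0 eK aeX lcX.
have rM : range eM = e @` M.
  apply/seteqP; split=> [_ [m _ <-]|_ [m Mm <-] ]; first by exists (set_val m) => //; exact: set_valP.
  by exists (exist (fun x => x \in M) m (mem_set Mm)).
have eM0 : e @` M !=set0 by have [m Mm] := M0; exists (e m), m.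
have eK0 : range e !=set0 by exists (e k0), k0.
pose dM (k : K) := setdist (e @` M) (e k).
have cdM : continuous dM by apply: continuous_setdist.
have dM_gt0 x : 0 < dM (i x).
  by apply: setdist_gt0 => // -[]; exists x.
split=> // Y hY lY lindY dimY A f cA [cf pf].
have nY : normal_space Y := @lindelof_normal R Y hY lY lindY.
have [u [cu u0 uc] ] := @exhaustion_function R Y hY lY lindY.
(* [i x0] is the value of [f'] outside [A]. *)
pose f' : Y -> K := valL_ (i x0) (i \o f).
have f'E a : f' (set_val a) = i (f a) := congr1 (fun h => h a) (valLK (i x0) (i \o f)).
have f'A y : A y -> exists x, f' y = i x.
  by move=> Ay; exists (f (exist (fun x => x \in A) y (mem_set Ay))); rewrite -f'E.
have cf' : {within A, continuous f'}.
  apply/subspace_valL_continuousP' => a.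
  by apply: continuous_comp; [exact: cf|exact: ci].
have [F0 [cF0 F0A F01] ] := embedding_extension nY eK cA cf'.
have [|y /eqP|g1 [cg1 _ _ g1F] ] := theta1P Y hY lY dimY F0 u cF0 cu _ uc.
- by move=> y; exact: ltW.
- by rewrite gt_eqF.
have ceg1 j : continuous (fun y => eM (g1 y) j).
  move=> y; apply: (@continuous_comp _ _ _ g1 (eM^~ j)); first exact: cg1.
  by case: eM' => _ + _ _; exact.
pose D y j := F0 y j - eM (g1 y) j.
have [|y j|r r0|q [cq qA qc] ] := @extend_vanishing Y A D 2 hY lY cA.
- by move=> j y; apply: cvgB; [exact: cF0|exact: ceg1].
- rewrite (le_trans (ler_normB _ _))// (_ : 2 = 1 + 1 :> R)// lerD//.
  exact: e1.
- have [_ _ /(_ r r0)[del del0 delP] ] := mtheta1.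
  have del20 : 0 < del / 2 by rewrite divr_gt0.
  pose L := [set k | del / 2 <= dM k].
  exists ([set y | del / 2 <= u y] `|` set_val @` (f @^-1` (i @^-1` L))).
    apply: compactU; first exact: uc.
    apply: continuous_compact; first by apply: continuous_subspaceT; exact: set_type_val_continuous.
    apply: pf; apply: embedding_preimage_compact => //.
      apply: subclosed_compact cK _ => //.
      by apply: (@closed_comp _ _ dM [set t | _ <= t]) => [k _|]; [exact: cdM|exact: closed_ge].
    move=> k Lk; apply: contrapT => Mk.
    suff : dM k = 0 by have : del / 2 <= dM k := Lk; lra.
    by apply: setdist0; exists k.
  move=> y Ay /not_orP[/negP]; rewrite -ltNge => uy nL.
  have dy : setdist (range eM) (F0 y) < del / 2.
    rewrite rM F0A// ltNge; apply/negP => Ly; apply: nL.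
    exists (exist (fun x => x \in A) y (mem_set Ay)) => //=.
    by rewrite -f'E.
  rewrite (@le_trans _ _ (seqdist (eM (g1 y)) (F0 y)))//.
    apply: seqdist_mono => j.
    by rewrite /D sub0r opprB.
  apply: le_trans (g1F y (u0 y)) _; apply: delP; first exact: ltr_wpDr (setdist_ge0 _ _) _.
  by rewrite [ltRHS]splitr ltrD.
pose F1 y j := eM (g1 y) j + q y j.
have cF1 j : continuous (F1^~ j).
  by move=> y; apply: cvgD; [exact: ceg1|exact: cq].
have F1A y : A y -> F1 y = e (f' y).
  by move=> Ay; rewrite /F1 qA// -F0A//; apply/funext => j; rewrite /D addrC subrK.
have F1g1 y : seqdist (eM (g1 y)) (F1 y) <= seqdist (fun=> 0) (q y).
  by apply: seqdist_mono => j; rewrite /F1 opprD addNKr sub0r.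
pose dK y := setdist (range e) (F1 y).
have cdK : continuous dK by apply: continuous_setdist.
pose dMF y := setdist (e @` M) (F1 y).
have cdMF : continuous dMF by apply: continuous_setdist.
have [||s' [cs' s'01 s'A s'N] ] := @normal_separation R Y A [set y | dMF y <= 0] nY cA.
- by apply: (@closed_comp _ _ dMF [set t | t <= 0]) => [y _|]; [exact: cdMF|exact: closed_le].
- rewrite -subset0 => y [Ay]; have [x xy] := f'A y Ay.
  by rewrite /= /dMF F1A// xy leNgt dM_gt0.
have s'0 y : 0 <= s' y by case/andP: (s'01 y).
have dK0 y : 0 <= dK y by exact: setdist_ge0.
(* [s] vanishes on [A], forces the values into [X] where [F1] lies in [M], and
   wherever it vanishes [F1] is already a point of [K]. *)
pose s y := Num.min (u y) (dK y + s' y).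
have cs : continuous s.
  move=> y; apply: (@continuous_min R Y u (fun y => dK y + s' y)); first exact: cu.
  by apply: cvgD; [exact: cdK|exact: cs'].
have s0 y : 0 <= s y by rewrite le_min (ltW (u0 y)) addr_ge0.
have s_eq0 y : s y = 0 -> dK y = 0 /\ s' y = 0.
  rewrite /s minEle; case: ifP => _; first by move=> uy0; have := u0 y; rewrite uy0 ltxx.
  by move=> h; have := dK0 y; have := s'0 y; split; lra.
have [r r0|y /s_eq0[dKy _]|g2 [cg2 g2F g2X g2c] ] := theta2P Y hY lY dimY F1 s cF1 cs s0.
- apply: subclosed_compact (uc r r0) _.
    by apply: (@closed_comp _ _ s [set t | r <= t]) => [y _|]; [exact: cs|exact: closed_ge].
  by move=> y /=; rewrite le_min => /andP[].
- by apply: (setdist_embedding_eq0 eK k0); rewrite -/(dK y) dKy.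
have g2i y : range i (g2 y).
  have [sy|sy] := ltP 0 (s y); first by apply: contrapT; exact: g2X y sy.
  have {}sy : s y = 0 by apply/eqP; rewrite eq_le sy s0.
  apply: contrapT => Mg; have [_ s'y] := s_eq0 y sy.
  have : s' y = 1.
    have dMFy : dMF y = 0 by rewrite /dMF -(g2F y sy); apply: setdist0; exists (g2 y).
    by apply: s'N; rewrite /= dMFy.
  by rewrite s'y => /eqP; rewrite eq_sym oner_eq0.
have /choice[g gP] : forall y, exists x, i x = g2 y by move=> y; have [x _ xy] := g2i y; exists x.
have ig : i \o g = g2 by apply/funext.
have cg : continuous g by apply: (embedding_continuousP oX); rewrite ig.
have ginf r : 0 < r -> exists2 Q, compact Q & forall y, ~ Q y -> dM (i (g y)) <= r.
  move=> r0; have r20 : 0 < r / 2 by rewrite divr_gt0.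
  have [_ _ /(_ _ r20)[del del0 delP] ] := mtheta2.
  have del20 : 0 < del / 2 by rewrite divr_gt0.
  pose eta := Num.min (r / 2) (del / 2).
  have eta0 : 0 < eta by rewrite lt_min r20.
  have [eta_r eta_del] : eta <= r / 2 /\ eta <= del / 2 by split; rewrite ge_min lexx ?orbT.
  exists ([set y | eta <= u y] `|` [set y | eta <= seqdist (fun=> 0) (q y)]).
    by apply: compactU; [exact: uc|exact: qc].
  move=> y /not_orP[/negP + /negP]; rewrite -!ltNge gP => uy qy.
  have F1y := le_lt_trans (F1g1 y) qy.
  have Mg1 : (e @` M) (eM (g1 y)) by rewrite -rM; exists (g1 y).
  apply: le_trans (setdist_le _ Mg1) _.
  apply: le_trans (seqdist_triangle (F1 y) _ _) _.
  rewrite (seqdistC (F1 y)) (splitr r); apply: lerD; last exact/ltW/(lt_le_trans F1y).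
  have [sy|sy] := ltP 0 (s y); last first.
    by rewrite g2F ?seqdistxx ?(ltW r20)//; apply/eqP; rewrite eq_le sy s0.
  apply: le_trans (g2c y sy) _; apply: delP; first exact: ltr_wpDr (setdist_ge0 _ _) sy.
  rewrite (splitr del); apply: ltrD.
    by apply: le_lt_trans (lt_le_trans uy eta_del); rewrite ge_min lexx.
  apply: le_lt_trans (lt_le_trans F1y eta_del); rewrite seqdistC.
  by apply: setdist_le; exists (set_val (g1 y)).
exists g.
  split=> // L cL; have [tau tau0 Ltau] : exists2 tau, 0 < tau & forall x, L x -> tau <= dM (i x).
    apply: (compact_positive_min (f := dM \o i)) => // x; last by move=> _; exact: dM_gt0.
    by apply: continuous_comp; [exact: ci|exact: cdM].
  have tau20 : 0 < tau / 2 by rewrite divr_gt0.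
  have [Q cQ Qtau] := ginf _ tau20.
  apply: subclosed_compact cQ _.
    by apply: closed_comp (compact_closed hX cL) => y _; exact: cg.
  move=> y Ly; apply: contrapT => /Qtau; have := Ltau _ Ly; lra.
move=> a; apply: ii; rewrite gP -f'E; apply: ie.
have Aa : A (set_val a) := set_valP a.
rewrite g2F ?F1A// /s s'A// addr0 /dK F1A// setdist0; last by exists (f' (set_val a)).
by apply/min_idPr/ltW.
Qed.

End Compactifications.

(** * The one-point compactification *)

Section OnePoint.
Context {R : realType} {n : nat}.

(** The range of [Some] is a relative absolute extensor, locally connected at its
    points by [relLC_at] and at infinity by [relLC_infinity]. A map to the
    one-point compactification, extended to the ambient space of sequences by
    Tietze's theorem, is pushed back off the given closed set; a map on the cube
    is pushed off the point at infinity by a small constant [s]. *)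
Lemma one_point_compactification_AE_Zset (X : metricType R) : (0 < n)%N ->
  locally_compact [set: X] -> separable X -> AEp n X ->
  AE R n (one_point_compactification X) /\
  Zset R n [set (None : one_point_compactification X)].
Proof.
move=> n0 lX sX aeX; pose opc := one_point_compactification X.
have [x0 _] := @AEp_nonempty R n X aeX.
have [e eX] := one_point_compactification_embedding x0 lX sX.
have [_ ce e1 ie] := eX; pose S := range (Some : X -> opc).
have lcS : relLC R n S.
  case=> [x|] V xV; last exact: relLC_infinity aeX eX V xV.
  by apply: (relLC_at n0 eX (AEp_relAE aeX)) xV; exists x.
have [theta mtheta thetaP] := controlled_extension (None : opc) eX (AEp_relAE aeX) lcS.
have eS0 : range e !=set0 by exists (e None), None.
split.
  split; first exact: compact_locally_compact one_point_compactification_compact.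
    exact: seq_embedding_metrizable eX.
  move=> Y lY lindY dimY A f cA cf; have hY : hausdorff_space Y by exact: metric_hausdorff.
  have nY : normal_space Y := @lindelof_normal R Y hY lY lindY.
  have [u [cu u0 uc] ] := @exhaustion_function R Y hY lY lindY.
  pose f' : Y -> opc := valL_ (None : opc) f.
  have f'E a : f' (set_val a) = f a := congr1 (fun h => h a) (valLK (None : opc) f).
  have cf' : {within A, continuous f'} by apply/subspace_valL_continuousP'.
  have [F [cF FA _] ] := embedding_extension nY eX cA cf'.
  pose d y := setdist (range e) (F y).
  have cd : continuous d by apply: continuous_setdist.
  have d0 y : 0 <= d y by exact: setdist_ge0.
  pose s y := Num.min (u y) (d y).
  have s_eq0 y : d y = 0 <-> s y = 0.
    rewrite /s minElt; split=> [->|]; first by rewrite ltNge (ltW (u0 y)).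
    by case: ifP => // _ uy0; have := u0 y; rewrite uy0 ltxx.
  have [||r r0|y /s_eq0 dy|g [cg gF _ _] ] := thetaP Y hY lY dimY F s cF.
  - by move=> y; apply: (@continuous_min R Y u d); [exact: cu|exact: cd].
  - by move=> y; rewrite le_min (ltW (u0 y)) d0.
  - apply: subclosed_compact (uc r r0) _ => [|y /=]; last by rewrite le_min => /andP[].
    apply: (@closed_comp _ _ s [set t | r <= t]) => [y _|]; last exact: closed_ge.
    by apply: (@continuous_min R Y u d); [exact: cu|exact: cd].
  - by apply: (setdist_embedding_eq0 eX (None : opc)); rewrite -/(d y) dy.
  exists g => // a; apply: ie; have Aa : A (set_val a) := set_valP a.
  have sa : s (set_val a) = 0.
    by apply/s_eq0; apply: setdist0; rewrite FA//; exists (f' (set_val a)).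
  by rewrite (gF _ sa) FA// f'E.
apply: (Zset_of_approx eX).
  apply: compact_closed; last exact: compact_set1.
  by apply: one_point_compactification_hausdorff => //; exact: metric_hausdorff.
move=> h r ch r0; have [_ _ /(_ _ r0)[del del0 delP] ] := mtheta.
have del20 : 0 < del / 2 by rewrite divr_gt0.
have ceh j : continuous (fun z => e (h z) j).
  by move=> z; apply: (@continuous_comp _ _ _ h (e^~ j)); [exact: ch|exact: ce].
have [|z|t _|z /eqP|g [cg _ gS gh] ] := thetaP (cube R n) (@cube_hausdorff R n) _ cube_dim
    (e \o h) (fun=> del / 2) ceh (fun z => @cst_continuous _ _ _ z).
- by apply: compact_locally_compact; exact (cube_compact R n).
- exact: ltW.
- apply: subclosed_compact (cube_compact R n) _ => //.
  by apply: (@closed_comp _ _ (fun=> del / 2) [set t | _ <= t]) => [z _|]; [exact: cst_continuous|exact: closed_ge].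
- by rewrite gt_eqF.
exists g; split=> // z; first by have [x _ <-] := gS z del20.
rewrite seqdistC; apply: le_trans (gh z del20) _; rewrite setdist0; last by exists (h z).
by rewrite addr0; apply: delP => //; lra.
Qed.

Lemma singleton_AE (T : topologicalType) (t : T) :
  compact [set: T] -> metrizable R T -> (forall t', t' = t) -> AE R n T.
Proof.
move=> cT mT tT; split=> //; first exact: compact_locally_compact.
move=> Y _ _ _ A f _ _; exists (fun=> t); first exact: cst_continuous.
by move=> a; rewrite (tT (f a)).
Qed.

Section Avoiding.
Import ArrowAsCompactOpen.

(** Density applied to the whole space of maps, which contains a constant map. *)
Lemma Zset_avoiding_map (K : topologicalType) (A : set K) (k : K) :
  Zset R n A -> exists k', ~ A k'.
Proof.
move=> [_ dA]; have cc : continuous (fun _ : cube R n => k) by exact: cst_continuous.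
have [|g [_ gA] ] := dA setT _ openT.
  by exists (mkcts cc : continuousType (cube R n) K).
by exists (g (to_cube (fun=> 0))); apply: gA; exists (to_cube (fun=> 0)).
Qed.

End Avoiding.

Lemma one_point_compactificationP (X : topologicalType) :
  hausdorff_space X -> locally_compact [set: X] ->
  dense (range (Some : X -> one_point_compactification X)) ->
  compactification (Some : X -> one_point_compactification X).
Proof.
move=> hX lX dX; split=> //.
  split; first exact: one_point_compactification_compact.
  exact: one_point_compactification_hausdorff.
split; first by move=> x y [].
apply/seteqP; split=> [U oU|_ [V oV <-] ].
  exists (Some @` U); first exact: one_point_compactification_open_some.
  by apply/seteqP; split=> [x [y Uy [<-] ]|x Ux]//; exists x.
apply: open_comp oV => x _; exact: one_point_compactification_some_continuous.
Qed.

(** Take the one-point compactification itself: the remainder is a point, and the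
    Z-set condition excludes that it is isolated. *)
Lemma AE_one_point_compactification_Zset (X : metricType R) :
  locally_compact [set: X] -> separable X ->
  AE R n (one_point_compactification X) ->
  Zset R n [set (None : one_point_compactification X)] ->
  exists (K : topologicalType) (i : X -> K),
    [/\ compactification i /\ metrizable R K, AE R n K, AE R n (set_type (~` range i))
      & Zset R n (~` range i)].
Proof.
move=> lX sX aeK zN; pose opc := one_point_compactification X.
have [ [x0|] nx0] := Zset_avoiding_map (None : opc) zN; last by case: nx0.
have [e eX] := one_point_compactification_embedding x0 lX sX.
have rS : ~` range (Some : X -> opc) = [set None].
  apply/seteqP; split=> [ [x nx|//]|_ ->]; last by case.
  by case: nx; exists x.
have cN : closed [set (None : opc)] by case: zN.
have [cT _ _ _] := subset_embedding cN eX.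
exists opc, Some; rewrite rS; split=> //.
  split; last exact: seq_embedding_metrizable eX.
  apply: one_point_compactificationP => //; first exact: metric_hausdorff.
  move=> V [ [x Vx _|VN oV] ]; first by exists (Some x); split=> //; exists x.
  have [r r0 rV] := seq_embedding_nbhs eX (open_nbhs_nbhs (conj oV VN)).
  have r20 : 0 < r / 2 by rewrite divr_gt0.
  have [h [_ hN hr] ] := Zset_approx eX zN (fun z => @cst_continuous _ _ (None : opc) z) r20.
  pose z : cube R n := to_cube (fun=> 0).
  exists (h z); split; first by apply: rV; have := hr z; lra.
  by case: (h z) (hN z) => [x _|/(_ erefl)//]; exists x.
pose t : set_type [set (None : opc)] := exist (fun x => x \in [set (None : opc)]) None (mem_set erefl).
apply: (@singleton_AE _ t) => //.
  exact: seq_embedding_metrizable (subset_embedding cN eX).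
by move=> t'; apply: val_inj; exact: (set_valP t').
Qed.

End OnePoint.

Theorem theorem2p4 (R : realType) (n : nat) (X : metricType R) :
  (1 <= n)%N -> locally_compact [set: X] -> separable X ->
  [<-> AEp n X;
       AE R n (one_point_compactification X) /\
       Zset R n [set (None : one_point_compactification X)];
       exists (K : topologicalType) (i : X -> K),
         [/\ compactification i /\ metrizable R K,
             AE R n K,
             AE R n (set_type (~` range i))
           & Zset R n (~` range i)]].
Proof.
move=> n0 lX sX; tfae.
- exact: one_point_compactification_AE_Zset.
- by case; exact: AE_one_point_compactification_Zset.
- move=> [K [i [ [iK mK] aeK aeM zM] ] ].
  exact: compactification_AEp n0 (@metric_hausdorff R X) lX sX iK mK aeK aeM zM.
Qed.
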